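(* For $i=1,2$, let $K_i$ be a compact space, $E_i$ a Banach space and $\mathcal{H}_i$ a closed subspace of $\mathcal{C}(K_i,E_i)$. Suppose that $E_2$ does not contain an isomorphic copy of $c_0$, let $\mathcal{B}\subseteq K_2$ be a closed boundary for $\mathcal{H}_2$, and let $T:\mathcal{H}_1\to\mathcal{H}_2$ be an into isomorphism. Let $l,k\in\mathbb{N}$ with $l\ge k$. Suppose that one of the following conditions holds: (i) $\mathcal{W}_{\mathcal{H}_1}^{(l)}$ is nonempty and $\mathcal{B}^{(k)}\cap\Omega_{\mathcal{H}_2}$ is empty. (ii) $\mathcal{W}_{\mathcal{H}_1}^{(l)}$ is infinite and $\mathcal{B}^{(k)}\cap\Omega_{\mathcal{H}_2}$ is finite. (iii) $\mathcal{W}_{\mathcal{H}_1}^{(l)}$ and $\mathcal{B}^{(k)}\cap\Omega_{\mathcal{H}_2}$ are both finite, and $E_2^m$ does not contain an isomorphic copy of $E_1^n$, where $n=|\mathcal{W}_{\mathcal{H}_1}^{(l)}|$ and $m=|\mathcal{B}^{(k)}\cap\Omega_{\mathcal{H}_2}|$. Then $$\|T\|\,\|T^{-1}\|\ \ge\ \max\left\{3,\ \frac{2l+2-k}{k}\right\}.$$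
   Context: All topological spaces are Hausdorff; all Banach spaces are real and of dimension at least $1$ (this applies also to the subspaces $\mathcal{H}_i$). $\mathbb{N}=\{1,2,\dots\}$. $|M|$ denotes the cardinality of a set $M$. For a compact space $K$ and a Banach space $E$, $\mathcal{C}(K,E)$ is the space of continuous functions $K\to E$ with the norm $\|f\|=\sup_{x\in K}\|f(x)\|$, and $\mathcal{C}(K)=\mathcal{C}(K,\mathbb{R})$. For $f\in\mathcal{C}(K)$ and $e\in E$, $f\otimes e\in\mathcal{C}(K,E)$ is $x\mapsto f(x)e$. For $e^*\in E^*$ and $h\in \mathcal{C}(K,E)$, $e^*(h)\in\mathcal{C}(K)$ is $x\mapsto\langle e^*,h(x)\rangle$. Let $\mathcal{H}\subseteq\mathcal{C}(K,E)$ be a closed subspace. - The canonical scalar function space of $\mathcal{H}$ is $\mathcal{A}=$ the closed linear span of $\{e^*(h): e^*\in E^*,\ h\in\mathcal{H}\}$ in $\mathcal{C}(K)$, and $\mathcal{A}^E=\{h\in\mathcal{A}: h\otimes e\in\mathcal{H}\text{ for every } e\in E\}$. - The Choquet boundary $\operatorname{Ch}_{\mathcal{H}}K$ is the set of all $x\in K$ such that the evaluation functional $h\mapsto h(x)$, $h\in\mathcal{A}$, is an extreme point of the unit ball $B_{\mathcal{A}^*}$. - A point $x\in K$ is a weak peak point (with respect to $\mathcal{H}$) if for each neighbourhood $U$ of $x$ and each $\varepsilon\in(0,1)$ there is $h\in\mathcal{A}^E$ with $0\le h\le1$, $h(x)>1-\varepsilon$ and $h<\varepsilon$ on $\operatorname{Ch}_{\mathcal{H}}K\setminus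 U$. $\mathcal{W}_{\mathcal{H}}$ is the set of all weak peak points of $K$ with respect to $\mathcal{H}$. - $\Omega_{\mathcal{H}}=\{y\in K:\ g(y)\ne0\text{ for some }g\in\mathcal{H}\}$. - A set $\mathcal{B}\subseteq K$ is a boundary for $\mathcal{H}$ if $\|h\|=\sup_{x\in\mathcal{B}}\|h(x)\|$ for each $h\in\mathcal{H}$; it is a closed boundary if in addition it is closed in $K$. For a topological space $S$ (subsets carry the subspace topology), $S^{(0)}=S$, $S^{(1)}$ is the set of accumulation points of $S$ in $S$, and $S^{(j+1)}=(S^{(j)})^{(1)}$ for $j\in\mathbb{N}$. An into isomorphism is a linear map that is an isomorphism onto its range (not necessarily surjective), and $T^{-1}$ is then defined on the range of $T$. $E^n$ denotes the direct sum of $n$ copies of $E$ (with $E^0=\{0\}$); ''contains an isomorphic copy of'' means contains a subspace linearly isomorphic to. *)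

(* Defs.v *)
From HB Require Import structures.
From mathcomp Require Import all_boot all_order all_algebra.
From mathcomp Require Import all_classical all_reals interval_inference.
From mathcomp Require Import topology normedtype sequences.

Set Implicit Arguments.
Unset Strict Implicit.
Unset Printing Implicit Defensive.

Import Order.TTheory GRing.Theory Num.Theory.
Import numFieldNormedType.Exports.

Local Open Scope classical_set_scope.
Local Open Scope ring_scope.

HB.mixin Record isCompactHausdorff T & Topological T := {
  compact_setT : compact [set: T];
  hausdorff_setT : hausdorff_space T
}.

#[short(type="compactHausdorffType")]
HB.structure Definition CompactHausdorff :=
  {T of Topological T & isCompactHausdorff T}.

Section sup_norm.
Context {R : realType} {X : Type} {E : normedModType R}.
Implicit Types f g : X -> E.

Definition sup_norm f : R := sup (range (fun x => `|f x|)).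

Definition sup_bounded f := exists M : R, forall x, `|f x| <= M.

Lemma sup_norm_ub f x : sup_bounded f -> `|f x| <= sup_norm f.
Proof.
move=> [M fM]; apply: ub_le_sup; last by exists x.
by exists M => _ [y _ <-].
Qed.

Lemma sup_norm_le f (M : R) : 0 <= M -> (forall x, `|f x| <= M) ->
  sup_norm f <= M.
Proof.
move=> M0 fM; rewrite /sup_norm.
have [->|/set0P ne] := eqVneq (range (fun x => `|f x|)) set0; first by rewrite sup0.
by apply: ge_sup => // _ [x _ <-].
Qed.

Lemma sup_norm_ge0 f : 0 <= sup_norm f.
Proof.
have [[[r [x _ _]] ub]|/sup_out fsup] :=
  pselect (has_sup (range (fun x => `|f x|))); last by rewrite /sup_norm fsup.
by rewrite (le_trans (normr_ge0 (f x)))//; apply: ub_le_sup => //; exists x.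
Qed.

Lemma sup_normD f g : sup_bounded f -> sup_bounded g ->
  sup_norm (fun x => f x + g x) <= sup_norm f + sup_norm g.
Proof.
move=> bf bg; apply: sup_norm_le; first by rewrite addr_ge0 ?sup_norm_ge0.
by move=> x; rewrite (le_trans (ler_normD _ _))// lerD// sup_norm_ub.
Qed.

Lemma sup_normZ (a : R) f : sup_bounded f ->
  sup_norm (fun x => a *: f x) = `|a| * sup_norm f.
Proof.
move=> bf; apply/eqP; rewrite eq_le; apply/andP; split.
  apply: sup_norm_le; first by rewrite mulr_ge0 ?sup_norm_ge0.
  by move=> x; rewrite normrZ ler_wpM2l// sup_norm_ub.
have [->|a0] := eqVneq a 0; first by rewrite normr0 mul0r sup_norm_ge0.
rewrite -ler_pdivlMl ?normr_gt0//; apply: sup_norm_le.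
  by rewrite mulr_ge0 ?sup_norm_ge0// invr_ge0.
move=> x; rewrite ler_pdivlMl ?normr_gt0// -normrZ.
apply: (@sup_norm_ub (fun x => a *: f x)).
by case: bf => M fM; exists (`|a| * M) => y; rewrite normrZ ler_wpM2l.
Qed.

Lemma sup_norm0_eq0 f : sup_bounded f -> sup_norm f = 0 -> forall x, f x = 0.
Proof.
move=> bf f0 x; apply/eqP; rewrite -normr_eq0 eq_le normr_ge0 andbT -f0.
exact: sup_norm_ub.
Qed.

End sup_norm.

Section cfun.
Context {R : realType}.

(* The space C(K, E) with the supremum norm, finite because K is compact. *)
Definition cfun (K : compactHausdorffType) (E : normedModType R) : Type :=
  continuousType K E.

Context {K : compactHausdorffType} {E : normedModType R}.

HB.instance Definition _ := Choice.on (cfun K E).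

Implicit Types f g h : cfun K E.

Definition cfun_of (f : K -> E) (cf : continuous f) : cfun K E := mkcts cf.

Lemma cfunP f g : f =1 g -> f = g.
Proof. by move=> fg; apply/continuousEP. Qed.

Lemma cfun0_cts : continuous (fun _ : K => 0 : E).
Proof. by move=> x; exact: cvg_cst. Qed.

Lemma cfunD_cts f g : continuous (fun x => f x + g x).
Proof. by move=> x; apply: cvgD; exact: cts_fun. Qed.

Lemma cfunN_cts f : continuous (fun x => - f x).
Proof. by move=> x; apply: cvgN; exact: cts_fun. Qed.

Lemma cfunZ_cts (a : R) f : continuous (fun x => a *: f x).
Proof. by move=> x; apply: cvgZl_tmp; exact: cts_fun. Qed.

Definition cfun0 : cfun K E := cfun_of cfun0_cts.
Definition cfunD f g : cfun K E := cfun_of (@cfunD_cts f g).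
Definition cfunN f : cfun K E := cfun_of (@cfunN_cts f).
Definition cfunZ (a : R) f : cfun K E := cfun_of (@cfunZ_cts a f).

Let cfunDA : associative cfunD.
Proof. by move=> f g h; apply: cfunP => x /=; rewrite /mkcts addrA. Qed.
Let cfunDC : commutative cfunD.
Proof. by move=> f g; apply: cfunP => x /=; rewrite /mkcts addrC. Qed.
Let cfun0D : left_id cfun0 cfunD.
Proof. by move=> f; apply: cfunP => x /=; rewrite /mkcts add0r. Qed.
Let cfunND : left_inverse cfun0 cfunN cfunD.
Proof. by move=> f; apply: cfunP => x /=; rewrite /mkcts addNr. Qed.

HB.instance Definition _ :=
  GRing.isZmodule.Build (cfun K E) cfunDA cfunDC cfun0D cfunND.

Let cfunZA a b f : cfunZ a (cfunZ b f) = cfunZ (a * b) f.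
Proof. by apply: cfunP => x /=; rewrite /mkcts scalerA. Qed.
Let cfun1Z : left_id 1 cfunZ.
Proof. by move=> f; apply: cfunP => x /=; rewrite /mkcts scale1r. Qed.
Let cfunZDr : right_distributive cfunZ +%R.
Proof. by move=> a f g; apply: cfunP => x /=; rewrite /mkcts scalerDr. Qed.
Let cfunZDl f : {morph cfunZ^~ f : a b / a + b}.
Proof. by move=> a b; apply: cfunP => x /=; rewrite /mkcts scalerDl. Qed.

HB.instance Definition _ :=
  GRing.Zmodule_isLmodule.Build R (cfun K E) cfunZA cfun1Z cfunZDr cfunZDl.

Lemma cfun_bounded f : sup_bounded f.
Proof.
have cpt : compact (range f).
  apply: continuous_compact; last exact: compact_setT.
  by apply: continuous_subspaceT => x; exact: cts_fun.
have [M [_ fM]] := compact_bounded cpt.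
by exists (M + 1) => x; apply: fM; [rewrite ltrDl | exists x].
Qed.

Let cfun_normD f g : sup_norm (f + g : cfun K E) <= sup_norm f + sup_norm g.
Proof. exact: sup_normD (cfun_bounded f) (cfun_bounded g). Qed.
Let cfun_normZ a f : sup_norm (a *: f : cfun K E) = `|a| * sup_norm f.
Proof. exact: sup_normZ (cfun_bounded f). Qed.
Let cfun_norm0_eq0 f : sup_norm f = 0 -> f = 0.
Proof. by move=> f0; apply: cfunP; apply: sup_norm0_eq0 (cfun_bounded f) f0. Qed.

HB.instance Definition _ := @Lmodule_isNormed.Build R (cfun K E)
  (fun f => sup_norm f) cfun_normD cfun_normZ cfun_norm0_eq0.

End cfun.
Arguments cfun R K E : clear implicits.

Section tensor.
Context {R : realType} {K : compactHausdorffType} {E : normedModType R}.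

Lemma tensor_cts (f : cfun R K R^o) (e : E) : continuous (fun x => f x *: e).
Proof. by move=> x; apply: cvgZr_tmp; exact: cts_fun. Qed.

Definition tensor (f : cfun R K R^o) (e : E) : cfun R K E :=
  cfun_of (@tensor_cts f e).

End tensor.

(* A linear subspace of V, as a normed space with the norm induced by V. *)
Section submod.
Context {R : realType} {V : normedModType R}.

Record submod (U : submodClosed V) : Type :=
  Submod { submod_val :> V ; _ : submod_val \in U }.

Context {U : submodClosed V}.

HB.instance Definition _ := [isSub of submod U for @submod_val U].
HB.instance Definition _ := [Choice of submod U by <:].
HB.instance Definition _ := [SubChoice_isSubLmodule of submod U by <:].

Let submod_normD (x y : submod U) : `|val (x + y)| <= `|val x| + `|val y|.
Proof. by rewrite raddfD ler_normD. Qed.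
Let submod_normZ a (x : submod U) : `|val (a *: x)| = `|a| * `|val x|.
Proof. by rewrite linearZ normrZ. Qed.
Let submod_norm0_eq0 (x : submod U) : `|val x| = 0 -> x = 0.
Proof. by move=> /normr0_eq0 x0; apply: val_inj; rewrite x0 raddf0. Qed.

HB.instance Definition _ := @Lmodule_isNormed.Build R (submod U)
  (fun x => `|val x|) submod_normD submod_normZ submod_norm0_eq0.

End submod.

Section closed_linear_span.
Context {R : realType} {V : normedModType R}.

Definition linear_span (X : set V) : set V :=
  [set v | exists2 s : seq (R * V), (forall p, p \in s -> X p.2) &
                                    v = \sum_(p <- s) p.1 *: p.2].

Definition closed_linear_span (X : set V) : {pred V} :=
  fun v => v \in closure (linear_span X).

Lemma closed_linear_span_submod_closed (X : set V) :
  submod_closed (closed_linear_span X).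
Proof.
split.
  rewrite /in_mem /=; apply/mem_set; apply: subset_closure.
  by exists [::]; [move=> p; rewrite in_nil | rewrite big_nil].
move=> a u v /set_mem Xu /set_mem Xv; apply/mem_set.
move=> B /(@add_continuous _ (a *: u, v) _) [[B1 B2] /= [B1u B2v] B12].
have /(Xu _) [u' [[s sX ->] B1s]] : nbhs u (fun w => B1 (a *: w)).
  exact: (@scaler_continuous _ V a u _ B1u).
have [v' [[t tX ->] B2t]] := Xv _ B2v.
exists (a *: (\sum_(p <- s) p.1 *: p.2) + \sum_(p <- t) p.1 *: p.2).
split; last exact: (B12 (_, _)).
exists ([seq (a * p.1, p.2) | p <- s] ++ t).
  by move=> p; rewrite mem_cat => /orP[/mapP[q qs ->]/=|/tX//]; exact: sX.
rewrite big_cat/= big_map scaler_sumr; congr (_ + _).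
by apply: eq_bigr => p _; rewrite scalerA.
Qed.

HB.instance Definition _ (X : set V) :=
  GRing.isSubmodClosed.Build R V (closed_linear_span X)
    (closed_linear_span_submod_closed X).

End closed_linear_span.

Section operators.
Context {R : realType}.

(* The operator norm of a map which is only meaningful on the subset D. *)
Definition opnorm_on {V W : normedModType R} (D : set V) (f : V -> W) : R :=
  sup [set `|f x| | x in D `&` [set x | `|x| <= 1]].

Definition opnorm {V W : normedModType R} (f : V -> W) : R := opnorm_on setT f.

(* T is an isomorphism onto its range, and Tinv, whose values outside the range
   of T are irrelevant, is its inverse there. *)
Definition into_isomorphism {V W : normedModType R}
    (T : {linear V -> W}) (Tinv : W -> V) : Prop :=
  [/\ continuous T, cancel T Tinv & {within range T, continuous Tinv}].

Definition contains_isomorphic_copy (W V : normedModType R) : Prop :=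
  exists (T : {linear V -> W}) (Tinv : W -> V), into_isomorphism T Tinv.

(* The closed unit ball of V^*, as a set of functions V -> R. *)
Definition dual_unit_ball (V : normedModType R) : set (V -> R^o) :=
  [set phi | [/\ linear phi, continuous phi & opnorm phi <= 1]].

Definition extreme_point {V : lmodType R} (C : set V) (p : V) : Prop :=
  C p /\ forall (y z : V) (t : R), C y -> C z -> 0 < t < 1 ->
         p = t *: y + (1 - t) *: z -> y = p /\ z = p.

End operators.
Arguments dual_unit_ball {R} V.

Section c0.
Context {R : realType}.

Definition c0_pred : {pred nat -> R^o} :=
  fun u => `[< u @ \oo --> (0 : R^o) >].

Record c0 : Type := C0 { c0_val :> nat -> R^o ; _ : c0_val \in c0_pred }.

HB.instance Definition _ := [isSub of c0 for c0_val].
HB.instance Definition _ := [Choice of c0 by <:].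

Lemma c0_submod_closed : submod_closed c0_pred.
Proof.
split; first by apply/asboolP; exact: cvg_cst.
move=> a u v /asboolP u0 /asboolP v0; apply/asboolP.
have -> : (0 : R^o) = a *: (0 : R^o) + 0 by rewrite scaler0 addr0.
by apply: cvgD => //; exact: cvgZl_tmp.
Qed.

HB.instance Definition _ :=
  GRing.isSubmodClosed.Build R (nat -> R^o) c0_pred c0_submod_closed.
HB.instance Definition _ := [SubChoice_isSubLmodule of c0 by <:].

Lemma c0_bounded (u : c0) : sup_bounded (val u).
Proof.
have u0 : val u @ \oo --> (0 : R^o) by apply/asboolP; exact: (valP u).
have [M [_ uM]] := cvg_seq_bounded (cvgP _ u0).
by exists (M + 1) => n; apply: uM; rewrite ?ltrDl.
Qed.

Let c0_normD (u v : c0) :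
  sup_norm (val (u + v)) <= sup_norm (val u) + sup_norm (val v).
Proof. by rewrite raddfD; exact: sup_normD (c0_bounded u) (c0_bounded v). Qed.
Let c0_normZ (a : R) (u : c0) :
  sup_norm (val (a *: u)) = `|a| * sup_norm (val u).
Proof. by rewrite linearZ; exact: sup_normZ (c0_bounded u). Qed.
Let c0_norm0_eq0 (u : c0) : sup_norm (val u) = 0 -> u = 0.
Proof.
move=> u0; apply: val_inj; rewrite raddf0; apply/funext.
exact: sup_norm0_eq0 (c0_bounded u) u0.
Qed.

HB.instance Definition _ := @Lmodule_isNormed.Build R c0
  (fun u => sup_norm (val u)) c0_normD c0_normZ c0_norm0_eq0.

End c0.
Arguments c0 R : clear implicits.

(* The direct sum of n copies of E, with the maximum norm. *)
Section dsum.
Context {R : realType}.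

Definition dsum (E : normedModType R) (n : nat) : Type := {ffun 'I_n -> E}.

Context {E : normedModType R} {n : nat}.

HB.instance Definition _ := GRing.Lmodule.on (dsum E n).

Lemma dsum_bounded (f : dsum E n) : sup_bounded f.
Proof.
exists (\sum_i `|f i|) => i; rewrite (bigD1 i)//= lerDl.
by apply: sumr_ge0.
Qed.

Let dsum_normD (f g : dsum E n) :
  sup_norm (f + g : dsum E n) <= sup_norm f + sup_norm g.
Proof.
rewrite (_ : sup_norm _ = sup_norm (fun i => f i + g i)).
  exact: sup_normD (dsum_bounded f) (dsum_bounded g).
by congr sup_norm; apply/funext => i; rewrite ffunE.
Qed.
Let dsum_normZ (a : R) (f : dsum E n) :
  sup_norm (a *: f : dsum E n) = `|a| * sup_norm f.
Proof.
rewrite -(sup_normZ a (dsum_bounded f)).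
by congr sup_norm; apply/funext => i; rewrite ffunE.
Qed.
Let dsum_norm0_eq0 (f : dsum E n) : sup_norm f = 0 -> f = 0.
Proof.
by move=> f0; apply/ffunP => i; rewrite (sup_norm0_eq0 (dsum_bounded f) f0) ffunE.
Qed.

HB.instance Definition _ := @Lmodule_isNormed.Build R (dsum E n)
  (fun f => sup_norm f) dsum_normD dsum_normZ dsum_norm0_eq0.

End dsum.

Section function_space.
Context {R : realType} {K : compactHausdorffType} {E : normedModType R}.
Variable H : submodClosed (cfun R K E).

Definition scalar_functions : set (cfun R K R^o) :=
  [set a | exists (e' : {linear E -> R^o}) (h : cfun R K E),
     [/\ continuous e', h \in H & forall x, a x = e' (h x)]].

(* The canonical scalar function space A of H. *)
Definition canonical_space : submodClosed (cfun R K R^o) :=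
  closed_linear_span scalar_functions.

(* A^E. *)
Definition canonical_space_tensor : set (cfun R K R^o) :=
  [set a | a \in canonical_space /\ forall e : E, tensor a e \in H].

Definition evaluation (x : K) : submod canonical_space -> R^o :=
  fun a => val a x.

Definition choquet_boundary : set K :=
  [set x | extreme_point (dual_unit_ball (submod canonical_space))
                         (evaluation x)].

Definition weak_peak_points : set K :=
  [set x | forall (U : set K) (eps : R), nbhs x U -> 0 < eps < 1 ->
     exists a : cfun R K R^o,
       [/\ canonical_space_tensor a, forall y, 0 <= a y <= 1, 1 - eps < a x &
           forall y, choquet_boundary y -> ~ U y -> a y < eps]].

(* Omega_H. *)
Definition nonvanishing : set K :=
  [set y | exists2 g : cfun R K E, g \in H & g y != 0].

Definition boundary (B : set K) : Prop :=
  forall h : cfun R K E, h \in H -> `|h| = sup [set `|h x| | x in B].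

End function_space.

(* S^(j); a point of S is an accumulation point of S for the subspace topology
   iff it is a limit point of S in the ambient space. *)
Definition derived_set {X : topologicalType} (S : set X) (j : nat) : set X :=
  iter j (fun A => A `&` limit_point A) S.

(* Main.v *)
(* Fix a unit vector [e] of [E1] and pick nested weak peak functions
   [h_0 >= h_1 >= ... >= h_l], with [h_0] peaking at a point of [W^(l)] and [h_j]
   at a point of [W^(l-j)] where the earlier ones are nearly [1]; then
   [|sum c_j h_j e|] is nearly the largest absolute value of a partial sum of the
   [c_j] (the norm is computed on the Choquet boundary).  As [E2] contains no copy
   of [c_0], among infinitely many disjoint candidates one can choose [h_j] so
   that [T h_j] is small on any given finite set, in particular on
   [B^(k) :&: Omega] and on the finite last derived sets of the level sets created
   so far.  Each new level set then lowers the derived length by one, so at every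
   [y] in [B] at most [k] of the vectors [a_j = T h_j y] are not small.

   If [j >= k] some [i < j] has [a_i] small, and [|h_i - 2 h_j| <= 1] gives
   [2 |a_j| <= |T|]; also [|a_j| <= |T|] for all [j].  Hence the function
   [h_0 + ... + h_(k-1) + 2 (h_k + ... + h_l)], whose norm is [2l+2-k], has image
   of norm at most [k |T|].  Likewise [h_0 + 2 h_l], of norm [3], has image of norm
   at most [|T|], by testing on [h_0 - 2 h_j + 2 h_l] for an index [j] with [a_j]
   small.

   In case (iii), [h_0 e] is replaced by a sum [sum_i g_i e_i] of peak functions at
   the points of [W^(l)], where [(e_i)] is chosen so that its image is small on
   [B^(k) :&: Omega], and [e] is an [e_i] of maximal norm; such [(e_i)] exists since
   otherwise evaluating the images there would embed [E1^n] into [E2^m]. *)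

Require Import Defs.
From HB Require Import structures.
From mathcomp Require Import all_boot all_order all_algebra finmap.
From mathcomp Require Import all_classical all_reals interval_inference.
From mathcomp Require Import topology normedtype sequences.
From mathcomp Require Import ring lra.

Set Implicit Arguments.
Unset Strict Implicit.
Unset Printing Implicit Defensive.

Import Order.TTheory GRing.Theory Num.Theory.
Import numFieldNormedType.Exports.

Local Open Scope classical_set_scope.
Local Open Scope ring_scope.

(** * Bounded linear maps *)

Section operators.
Context {R : realType}.
Implicit Types V W : normedModType R.

Lemma linear_le_norm_continuous V W (f : {linear V -> W}) (M : R) :
  (forall x, `|f x| <= M * `|x|) -> continuous f.
Proof.
move=> fM; apply: bounded_linear_continuous.
apply/linear_boundedP; near=> r.
move=> x; apply: le_trans (fM x) _; apply: ler_wpM2r => //.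
by near: r; apply: nbhs_pinfty_ge; rewrite num_real.
Unshelve. all: by end_near. Qed.

Lemma continuous_linear_le_norm V W (f : {linear V -> W}) :
  continuous f -> exists M, forall x, `|f x| <= M * `|x|.
Proof.
move=> fc; have /linear_boundedP : bounded_near f (nbhs 0).
  by apply: continuous_linear_bounded; exact: fc.
move=> /pinfty_ex_gt0[M _ Mf]; exists M; exact: Mf.
Qed.

(** Homogeneity is asked only on [D], since [Tinv] is meaningful only on the range of [T]. The bound
    [M] keeps the supremum from taking its default value 0. *)
Lemma opnorm_on_le_norm V W (D : set V) (f : V -> W) (M : R) (x : V) :
  (forall a y, D y -> D (a *: y) /\ f (a *: y) = a *: f y) ->
  (forall y, D y -> `|y| <= 1 -> `|f y| <= M) ->
  D x -> `|f x| <= opnorm_on D f * `|x|.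
Proof.
move=> Dh fM Dx.
have ubd y : D y -> `|y| <= 1 -> `|f y| <= opnorm_on D f.
  move=> Dy y1; apply: ub_le_sup; last by exists y.
  by exists M => _ [z [Dz z1] <-]; exact: fM.
have [->|x0] := eqVneq x 0.
  rewrite -[X in f X](scale0r x) (Dh 0 x Dx).2 scale0r !normr0 mulr0//.
have nx : 0 < `|x| by rewrite normr_gt0.
have [Dy fy] := Dh (`|x|^-1) x Dx.
have := ubd _ Dy; rewrite fy !normrZ normfV normr_id mulVf ?gt_eqF//.
by move=> /(_ (lexx _)); rewrite ler_pdivrMl// mulrC.
Qed.

Lemma opnorm_le_norm V W (f : {linear V -> W}) (x : V) :
  continuous f -> `|f x| <= opnorm f * `|x|.
Proof.
move=> /continuous_linear_le_norm[M fM].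
apply: (@opnorm_on_le_norm _ _ _ _ `|M|) => //.
  by move=> a y _; rewrite linearZ.
move=> y _ y1; apply: le_trans (fM y) _.
by rewrite (le_trans (ler_norm _))// normrM normr_id ler_piMr.
Qed.

Lemma opnorm_le V W (f : V -> W) (M : R) :
  (forall x, `|x| <= 1 -> `|f x| <= M) -> opnorm f <= M.
Proof.
move=> fM; apply: ge_sup; first by exists `|f 0|, 0 => //; split=> //=; rewrite normr0.
by move=> _ [x [_ x1] <-]; exact: fM.
Qed.

Lemma dual_unit_ballP V (phi : V -> R^o) :
  dual_unit_ball V phi <-> linear phi /\ forall x, `|phi x| <= `|x|.
Proof.
split=> [[lphi cphi phi1]|[lphi phi1]].
  split=> // x.
  pose f := GRing.isLinear.Build _ _ _ _ _ lphi.
  pose g : {linear V -> R^o} := HB.pack phi f.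
  rewrite (le_trans (@opnorm_le_norm _ _ g x _))//.
  by rewrite ler_piMl.
have cphi : continuous phi.
  pose f := GRing.isLinear.Build _ _ _ _ _ lphi.
  pose g : {linear V -> R^o} := HB.pack phi f.
  by apply: (@linear_le_norm_continuous _ _ g 1) => x; rewrite mul1r; exact: phi1.
split=> //; apply: opnorm_le => x x1; exact: le_trans (phi1 x) x1.
Qed.

Lemma into_isomorphism_le_norm V W (T : {linear V -> W}) (Tinv : W -> V) (x : V) :
  into_isomorphism T Tinv -> `|x| <= opnorm_on (range T) Tinv * `|T x|.
Proof.
move=> [Tc TK Tic].
have hom a y : range T y -> range T (a *: y) /\ Tinv (a *: y) = a *: Tinv y.
  by move=> [z _ <-]; rewrite -linearZ !TK; split=> //; exists (a *: z).
have /subspace_continuousP /(_ (T 0)) := Tic.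
move=> /(_ (ex_intro2 _ _ 0 I erefl)) /cvgrPdist_lt /(_ 1 ltr01).
rewrite near_withinE => /nbhs_normP [r /= r0 rT].
rewrite /from_subspace TK in rT; rewrite -{1}(TK x).
(* Continuity at 0 gives [r] such that [z] has norm below 1 when [T z] has norm below [r]; scaling
   by [r / 2] stays strictly inside, whence the bound [2 / r]. *)
apply: (@opnorm_on_le_norm W V (range T) Tinv (2 / r) (T x)) => //.
  move=> y [z _ <-] z1; rewrite TK.
  have r20 : 0 < r / 2 by rewrite divr_gt0.
  have := rT (T ((r / 2) *: z)); rewrite TK sub0r normrN normrZ gtr0_norm//.
  move=> H; rewrite -(ler_pM2l r20) mulrA mulfVK ?mulfV ?gt_eqF//.
  apply/ltW/H; last by exists ((r / 2) *: z).
  rewrite /= linear0 /ball_ sub0r normrN linearZ normrZ gtr0_norm//.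
  rewrite (@le_lt_trans _ _ (r / 2))// ?ler_piMr// ?ltW//.
  by rewrite ltr_pdivrMr// ltr_pMr// ltr1n.
Qed.

Lemma bounded_below_contains_copy V W (T : {linear V -> W}) (M c : R) :
  0 < c -> (forall x, `|T x| <= M * `|x|) -> (forall x, c * `|x| <= `|T x|) ->
  contains_isomorphic_copy W V.
Proof.
move=> c0 TM Tc.
have Tinj x y : T x = T y -> x = y.
  move=> Txy; apply/eqP; rewrite -subr_eq0 -normr_le0 -(pmulr_rle0 _ c0).
  by rewrite (le_trans (Tc _))// linearB Txy subrr normr0.
pose Tinv y := if pselect (exists x, T x = y) is left e then projT1 (cid e) else 0.
have TK : cancel T Tinv.
  move=> x; rewrite /Tinv; case: pselect => [e|[]]; last by exists x.
  by case: cid => z /= /Tinj.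
exists T, Tinv; split=> //; first exact: linear_le_norm_continuous TM.
apply/subspace_continuousP => _ [x _ <-].
apply/cvgrPdist_lt => e e0; rewrite near_withinE.
apply/nbhs_normP; exists (c * e); first by rewrite /= mulr_gt0.
move=> y /= + [z _ zy]; rewrite /from_subspace -zy !TK /ball_ -linearB => H.
by rewrite -(ltr_pM2l c0) (le_lt_trans (Tc _)).
Qed.

End operators.

(** * The Hahn-Banach and Bessaga-Pelczynski theorems *)

Section hahn_banach.
Context {R : realType} {V : normedModType R}.
Implicit Types p q : V -> R.

(* The pointwise minimal sublinear functionals below the norm are linear; this
   yields the Hahn-Banach theorem without extending partial functionals. *)
Definition sublinear_le_norm p := [/\ forall u v, p (u + v) <= p u + p v,
  forall (a : R) v, 0 < a -> p (a *: v) = a * p v & forall v, p v <= `|v| ].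

Lemma sublinear0 p : sublinear_le_norm p -> p 0 = 0.
Proof. by case=> _ /(_ 2 0 (ltr0Sn _ _)); rewrite scaler0 => + _; lra. Qed.

Lemma sublinear_ge p v : sublinear_le_norm p -> - p (- v) <= p v.
Proof.
move=> sp; have [subp _ _] := sp.
by have := subp v (- v); rewrite subrr sublinear0//; lra.
Qed.

Lemma sublinear_geN p v : sublinear_le_norm p -> - `|v| <= p v.
Proof.
move=> sp; have [_ _ /(_ (- v))] := sp; rewrite normrN => pv.
by rewrite (le_trans _ (sublinear_ge v sp))// lerN2.
Qed.

(** Bounds for Zorn's lemma. The infimum is finite because members are at least minus the norm; of
    two members the smaller serves for both summands. *)
Lemma sublinear_inf (A : set (V -> R)) : A !=set0 ->
  A `<=` sublinear_le_norm ->
  total_on A (fun p q => forall v, q v <= p v) ->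
  sublinear_le_norm (fun v => inf [set p v | p in A]).
Proof.
move=> [p0 Ap0] Asub Atot.
have inf_ub p v : A p -> inf [set p v | p in A] <= p v.
  move=> Ap; apply: ge_inf; last by exists p.
  by exists (- `|v|) => _ [q /Asub + <-]; exact: sublinear_geN.
have inf_lb (x : R) v : (forall p, A p -> x <= p v) -> x <= inf [set p v | p in A].
  move=> H; apply: lb_le_inf; first by exists (p0 v), p0.
  by move=> _ [q Aq <-]; exact: H.
split=> [u v|a v a0|v].
- rewrite -lerBlDr; apply: (inf_lb) => p Ap; rewrite lerBlDr -lerBlDl.
  apply: (inf_lb) => q Aq; rewrite lerBlDl.
  have [pq|qp] := Atot p q Ap Aq.
    rewrite (le_trans (inf_ub _ _ Aq))//; have [+ _ _] := Asub _ Aq.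
    by move=> /(_ u v)/le_trans; apply; rewrite lerD2r.
  rewrite (le_trans (inf_ub _ _ Ap))//; have [+ _ _] := Asub _ Ap.
  by move=> /(_ u v)/le_trans; apply; rewrite lerD2l.
- apply/eqP; rewrite eq_le; apply/andP; split.
    rewrite -ler_pdivrMl//; apply: (inf_lb) => p Ap; rewrite ler_pdivrMl//.
    by have [_ pZ _] := Asub _ Ap; rewrite -pZ//; exact: inf_ub.
  apply: (inf_lb) => p Ap; have [_ pZ _] := Asub _ Ap.
  by rewrite pZ// ler_pM2l//; exact: inf_ub.
- by rewrite (le_trans (inf_ub _ _ Ap0))//; have [_ _] := Asub _ Ap0.
Qed.

(** For sublinear [p], the largest sublinear functional below [p] whose value at [- x] is at most
    [- p x]. A minimal [p] is fixed by every tilt, hence odd. *)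
Definition tilt p x : V -> R :=
  fun v => inf [set p (v + t *: x) - t * p x | t in [set t : R | 0 <= t]].

Lemma tiltP p x : sublinear_le_norm p ->
  [/\ sublinear_le_norm (tilt p x), forall v, tilt p x v <= p v &
      tilt p x (- x) = - p x].
Proof.
move=> sp; have [subp homp np] := sp.
have pZ t : 0 <= t -> p (t *: x) = t * p x.
  by rewrite le_eqVlt => /orP[/eqP<-|/homp//]; rewrite scale0r mul0r sublinear0.
have lb t v : 0 <= t -> - p (- v) <= p (v + t *: x) - t * p x.
  move=> t0; have := subp (v + t *: x) (- v).
  by rewrite addrC addKr pZ//; lra.
have tilt_le t v : 0 <= t -> tilt p x v <= p (v + t *: x) - t * p x.
  move=> t0; apply: ge_inf; last by exists t.
  by exists (- p (- v)) => _ [s s0 <-]; exact: lb.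
have le_tilt (r : R) v : (forall t, 0 <= t -> r <= p (v + t *: x) - t * p x) ->
    r <= tilt p x v.
  move=> H; apply: lb_le_inf; last by move=> _ [t t0 <-]; exact: H.
  by exists (p (v + 0 *: x) - 0 * p x), 0 => //=.
have tilt_lep v : tilt p x v <= p v.
  by rewrite (le_trans (tilt_le 0 v (lexx _)))// scale0r addr0 mul0r subr0.
split=> //; last first.
  apply/eqP; rewrite eq_le; apply/andP; split.
    rewrite (le_trans (tilt_le 1 _ ler01))// scale1r addNr sublinear0//.
    by rewrite mul1r sub0r.
  by apply: (le_tilt) => t t0; rewrite (le_trans _ (lb _ _ t0))// opprK.
split=> [u v|a v a0|v]; last exact: le_trans (np v).
- rewrite -lerBlDr; apply: (le_tilt) => s s0; rewrite lerBlDr -lerBlDl.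
  apply: (le_tilt) => t t0; rewrite lerBlDl.
  rewrite (le_trans (tilt_le (s + t) _ _)) ?addr_ge0//.
  have := subp (u + s *: x) (v + t *: x).
  by rewrite addrACA -scalerDl; lra.
- apply/eqP; rewrite eq_le; apply/andP; split.
    rewrite -ler_pdivrMl//; apply: (le_tilt) => t t0; rewrite ler_pdivrMl//.
    rewrite (le_trans (tilt_le (a * t) _ _)) ?mulr_ge0 ?(ltW a0)//.
    by rewrite -scalerA -scalerDr homp// mulrBr mulrA.
  apply: (le_tilt) => t t0; rewrite -ler_pdivlMl//.
  rewrite (le_trans (tilt_le (a^-1 * t) _ _)) ?mulr_ge0 ?invr_ge0 ?(ltW a0)//.
  rewrite ler_pdivlMl// mulrBr -homp// scalerDr !scalerA !(mulrA a).
  by rewrite mulfV ?gt_eqF// mul1r.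
Qed.

(** A minimal sublinear functional below the norm tilted at [x] is odd, hence linear; its value at
    [- x] is at most minus the norm of [x]. *)
Lemma hahn_banach_norming (x : V) :
  exists2 f : {linear V -> R^o}, (forall v, `|f v| <= `|v|) & f x = `|x|.
Proof.
pose n (v : V) := `|v|.
have sn : sublinear_le_norm n.
  split=> [u v|a v a0|//]; first exact: ler_normD.
  by rewrite /n normrZ gtr0_norm.
have [sq qn qx] := tiltP x sn; set q := tilt n x in sq qn qx.
pose S := {p | sublinear_le_norm p /\ forall v, p v <= q v}.
(* The order is reversed: a maximal element is a pointwise minimal functional. *)
pose le (p1 p2 : S) := `[< forall v, sval p2 v <= sval p1 v >].
have [| | | |[p [sp pq]] pmin] := @Zorn S le.
- by move=> t; apply/asboolP.
- move=> r s t /asboolP rs /asboolP st; apply/asboolP => v.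
  exact: le_trans (st v) (rs v).
- move=> [s Ps] [t Pt] /asboolP/= st /asboolP/= ts; apply: eq_exist.
  by apply/funext => v; apply/eqP; rewrite eq_le st ts.
- move=> A Atot; have [A0|/set0P[s0 As0]] := eqVneq A set0.
    by exists (exist _ q (conj sq (fun v => lexx _))) => s; rewrite A0.
  have As : [set sval s | s in A] (sval s0) by exists s0.
  have si := @sublinear_inf [set sval s | s in A] (ex_intro _ _ As).
  have {}si := si _ _; set r := (X in _ -> _ -> sublinear_le_norm X) in si.
  have {}si : sublinear_le_norm r.
    apply: si => [_ [s _ <-]|_ _ [s sA <-] [t tA <-]]; first by have [] := svalP s.
    by have [/asboolP|/asboolP] := Atot _ _ sA tA; [left|right].
  have rA s v : A s -> r v <= sval s v.
    move=> sA; apply: ge_inf; last by exists (sval s) => //; exists s.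
    exists (- `|v|) => _ [_ [t _ <-] <-].
    by apply: sublinear_geN; have [] := svalP t.
  have rq v : r v <= q v.
    by rewrite (le_trans (rA _ _ As0))//; have [_] := svalP s0.
  exists (exist _ r (conj si rq)) => s sA; apply/asboolP => v; exact: rA.
have p_tilt v : tilt p v = p.
  have [st tp _] := tiltP v sp.
  have H : sublinear_le_norm (tilt p v) /\ forall w, tilt p v w <= q w.
    by split=> // w; exact: le_trans (pq w).
  by have /(congr1 sval)/= := pmin (exist _ _ H) (introT (asboolP _) tp).
have pN v : p (- v) = - p v.
  by have [_ _] := tiltP v sp; rewrite p_tilt.
have [subp homp np] := sp.
have lin : linear (p : V -> R^o).
  have pD u v : p (u + v) = p u + p v.
    apply/eqP; rewrite eq_le subp/=.
    by have := subp (- u) (- v); rewrite -opprD !pN; lra.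
  have pZ a v : p (a *: v) = a * p v.
    have [a0|a0|->] := ltgtP a 0; last by rewrite scale0r mul0r sublinear0.
      by rewrite -[in LHS](opprK a) scaleNr pN homp ?oppr_gt0// mulNr opprK.
    exact: homp.
  by move=> a u v; rewrite pD pZ.
pose f0 := GRing.isLinear.Build _ _ _ _ _ lin.
pose f : {linear V -> R^o} := HB.pack (p : V -> R^o) f0.
exists f => [v|]; first by rewrite ler_norml sublinear_geN/=.
apply/eqP; rewrite eq_le np/=.
by have := pq (- x); rewrite qx pN; rewrite lerN2.
Qed.

End hahn_banach.

(** * Rosenthal's lemma and copies of c_0 *)

Section bessaga_pelczynski.
Context {R : realType}.

(* Rosenthal's lemma: if every class of a partition of nat into infinitely many
   infinite classes has a row [k] whose off-diagonal mass in the class exceeds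
   [eps], then along these [k]'s all row sums drop by [eps]. *)
Lemma rosenthal (a : nat -> nat -> R) (eps : R) (m : nat) : 0 <= eps ->
  (forall i (s : seq nat), uniq s -> \sum_(j <- s) a i j <= m%:R * eps) ->
  exists2 iota : nat -> nat, injective iota & forall k (s : seq nat),
    uniq s -> k \notin s -> \sum_(j <- s) a (iota k) (iota j) <= eps.
Proof.
move=> eps0; elim: m a => [|m IHm] a am.
  exists id; first exact: inj_id.
  by move=> k s us _; rewrite (le_trans (am k s us))// mul0r.
pose cls (p n : nat) : nat := choice.pickle (p, n).
have cls_inj p n q r : cls p n = cls q r -> (p, n) = (q, r).
  by move/(pcan_inj choice.pickleK).
have [[p Hp]|/forallNP H] := pselect (exists p, forall k (s : seq nat),
    uniq s -> k \notin s -> \sum_(j <- s) a (cls p k) (cls p j) <= eps).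
  by exists (cls p) => // x y /cls_inj[].
have /choice[f Hf] p : exists ks : nat * seq nat, [/\ uniq ks.2, ks.1 \notin ks.2 &
    eps < \sum_(j <- ks.2) a (cls p ks.1) (cls p j)].
  have /existsNP[k /existsNP[s /not_implyP[us /not_implyP[ks /negP]]]] := H p.
  by rewrite -ltNge => hs; exists (k, s).
pose kap p := cls p (f p).1.
have kap_inj : injective kap by move=> p q /cls_inj[].
(* Row [kap p] has mass above [eps] on a part of class [p] that avoids all the rows [kap q], so at
   most [m * eps] remains on these. *)
have [|iota iota_inj Hi] := IHm (fun p q => a (kap p) (kap q)).
  move=> p t ut; have [us ks hs] := Hf p.
  have : uniq (map kap t ++ map (cls p) (f p).2).
    rewrite cat_uniq !map_inj_uniq ?ut ?us //; last by move=> x y /cls_inj[].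
    rewrite andbT; apply/hasPn => _ /mapP[n ns ->].
    apply/negP => /mapP[q _ /cls_inj[pq nq]].
    by move: ks; rewrite pq -nq -pq ns.
  move=> /(am (kap p)); rewrite big_cat !big_map -natr1 mulrDl mul1r.
  by rewrite /kap /= in hs *; lra.
by exists (kap \o iota) => //; exact: inj_comp.
Qed.

Variable E : completeNormedModType R.

(** A norming functional of the sum reduces the estimate to scalar series. *)
Lemma unconditional_le (z : nat -> E) (M b : R) (c : nat -> R) (s : seq nat) :
  (forall (phi : {linear E -> R^o}) (s : seq nat), (forall v, `|phi v| <= `|v|) ->
    uniq s -> \sum_(n <- s) `|phi (z n)| <= M) ->
  uniq s -> (forall n, n \in s -> `|c n| <= b) ->
  0 <= b -> `|\sum_(n <- s) c n *: z n| <= b * M.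
Proof.
move=> zM us cb b0.
have [phi phi1 <-] := hahn_banach_norming (\sum_(n <- s) c n *: z n).
rewrite (le_trans (ler_norm _))// linear_sum (le_trans (ler_norm_sum _ _ _))//.
rewrite (@le_trans _ _ (\sum_(n <- s) b * `|phi (z n)|))//; last first.
  by rewrite -mulr_sumr ler_wpM2l// zM.
rewrite big_seq [leRHS]big_seq; apply: ler_sum => n ns.
by rewrite linearZ normrM ler_wpM2r// cb.
Qed.

Lemma c0_le_norm (c : c0 R) n : `|c n| <= `|c|.
Proof. exact: (sup_norm_ub n (c0_bounded c)). Qed.

(** Rosenthal's lemma for norming functionals of the [z i], evaluated at the [z j], gives a
    subsequence with off-diagonal mass at most [d / 2]. Along it, summing with coefficients in c_0
    is bounded below, as each functional sees its own coordinate. *)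
Lemma bessaga_pelczynski (z : nat -> E) (M d : R) : 0 < d ->
  (forall n, d <= `|z n|) ->
  (forall (phi : {linear E -> R^o}) (s : seq nat), (forall v, `|phi v| <= `|v|) ->
    uniq s -> \sum_(n <- s) `|phi (z n)| <= M) ->
  contains_isomorphic_copy E (c0 R).
Proof.
move=> d0 dz zM.
have /choice[phi Hphi] n : exists phi : {linear E -> R^o},
    (forall v, `|phi v| <= `|v|) /\ phi (z n) = `|z n|.
  by have [phi ? ?] := hahn_banach_norming (z n); exists phi.
have d20 : 0 < d / 2 by rewrite divr_gt0.
(* Chosen so that [M] is at most [m + 1] times [d / 2]. *)
pose m := Num.truncn (M / (d / 2)).
have [|iota iota_inj Hi] :=
    @rosenthal (fun i j => `|phi i (z j)|) (d / 2) m.+1 (ltW d20).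
  move=> i s us; rewrite (le_trans (zM _ _ (Hphi i).1 us))//.
  by rewrite -ler_pdivrMr// ltW// truncnS_gt.
pose w n := z (iota n).
have wM (p : {linear E -> R^o}) (s : seq nat) : (forall v, `|p v| <= `|v|) ->
    uniq s -> \sum_(n <- s) `|p (w n)| <= M.
  move=> p1 us; rewrite -(big_map iota predT (fun n => `|p (z n)|)) zM//.
  by rewrite map_inj_uniq.
have M0 : 0 <= M by have := zM _ [::] (Hphi 0%N).1 isT; rewrite big_nil.
have wcvg (c : c0 R) : cvgn (series (fun n => c n *: w n)).
  apply/cauchy_cvgP/cauchy_seriesP => e e0.
  have e1 : 0 < e / (M + 1) by rewrite divr_gt0// ltr_wpDl.
  have : c0_val c @ \oo --> (0 : R^o) by apply/asboolP; exact: (valP c).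
  move=> /cvgrPdist_lt /(_ _ e1) [N _ cN].
  exists ([set n | (N <= n)%N], setT) => /=.
    by split; [exists N | exact: filterT].
  move=> [n1 n2] [/= n1N _].
  rewrite (le_lt_trans (@unconditional_le w M (e / (M + 1)) c _ wM _ _ _))//.
  - exact: iota_uniq.
  - move=> n; rewrite mem_index_iota => /andP[n1n _].
    have := cN n (leq_trans n1N n1n).
    by rewrite /= sub0r normrN => /ltW.
  - exact: ltW.
  - by rewrite -mulrA -[ltRHS]mulr1 ltr_pM2l// mulrC ltr_pdivrMr ?mul1r ?ltrDl// ltr_wpDl.
pose S (c : c0 R) n := \sum_(0 <= k < n) c k *: w k.
pose T0 (c : c0 R) := limn (series (fun n => c n *: w n)).
have T0cvg c : S c @ \oo --> T0 c by exact: wcvg.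
have T0lin : linear T0.
  move=> a c c'; apply: cvg_lim => //.
  have -> : series (fun n => (a *: c + c') n *: w n) = (fun n => a *: S c n + S c' n).
    apply/funext => n; rewrite /series/= /S scaler_sumr -big_split/=.
    by apply: eq_bigr => k _; rewrite scalerA -scalerDl.
  by apply: cvgD; [apply: cvgZl_tmp|]; exact: T0cvg.
pose T1 := GRing.isLinear.Build _ _ _ _ _ T0lin.
pose T : {linear c0 R -> E} := HB.pack T0 T1.
have Tnorm c : `|S c n| @[n --> \oo] --> `|T c| by exact: cvg_norm (T0cvg c).
have Tle (c : c0 R) : `|T c| <= M * `|c|.
  apply: (cvgr_to_le (Tnorm c)).
  near=> n; rewrite mulrC; apply: (unconditional_le wM) => //; first exact: iota_uniq.
  by move=> k _; exact: c0_le_norm.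
have Tge (c : c0 R) : d / 2 * `|c| <= `|T c|.
  suff ck k : d * `|c k| <= `|T c| + d / 2 * `|c|.
    have : `|c| <= (`|T c| + d / 2 * `|c|) / d.
      apply: sup_norm_le => [|k]; last by rewrite ler_pdivlMr// mulrC; exact: ck.
      by apply: divr_ge0 (ltW d0); rewrite addr_ge0// mulr_ge0// ltW.
    by rewrite ler_pdivlMr//; lra.
  rewrite -lerBlDr.
  apply: (cvgr_to_ge (Tnorm c)).
  near=> n; have [phi1 phiz] := Hphi (iota k).
  rewrite (le_trans _ (phi1 _))// linear_sum/=.
  have kn : (k < n)%N by near: n; exists k.+1.
  rewrite (bigD1_seq k)/= ?mem_index_iota ?iota_uniq// [phi _ _]linearZ/=.
  rewrite -/(w k) in phiz; rewrite phiz.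
  rewrite lerBlDr.
  have : d * `|c k| <= `|c k * `|w k| |.
    by rewrite normrM normr_id mulrC ler_wpM2l//; exact: dz.
  have : `|\sum_(0 <= j < n | j != k) phi (iota k) (c j *: w j)| <= d / 2 * `|c|.
    rewrite (le_trans (ler_norm_sum _ _ _))//.
    rewrite (@le_trans _ _ (\sum_(0 <= j < n | j != k) `|phi (iota k) (w j)| * `|c|))//.
      apply: ler_sum => j _; rewrite linearZ normrM mulrC ler_wpM2l//.
      exact: c0_le_norm.
    rewrite -mulr_suml ler_wpM2r// -big_filter Hi ?filter_uniq ?iota_uniq//.
    by rewrite mem_filter eqxx.
  set u := _ * `|w k|; set v := \sum_(_ <= _ < _ | _) _ => vle ule.
  have := ler_normB (u + v) v; rewrite addrK.
  by lra.
exact: bounded_below_contains_copy d20 Tle Tge.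
Unshelve. all: by end_near. Qed.

End bessaga_pelczynski.

(** * The Choquet boundary *)

Section choquet.

(** A cluster point of the filter generated by the chain lies in every member; [x] is the answer for
    the empty chain. *)
Lemma compact_chain (T : topologicalType) (G : set (set T)) (x : T) :
  compact [set: T] -> (forall X, G X -> closed X) -> (forall X, G X -> X !=set0) ->
  total_on G subset -> exists t, forall X, G X -> X t.
Proof.
move=> cT Gcl G0 Gtot.
have [->|/set0P[X0 GX0]] := eqVneq G set0; first by exists x.
have FF : ProperFilter (filter_from G id).
  apply: filter_from_proper => //; apply: filter_from_filter; first by exists X0.
  move=> X Y GX GY; have [XY|YX] := Gtot _ _ GX GY.
    by exists X => // z Xz; split=> //; exact: XY.
  by exists Y => // z Yz; split=> //; exact: YX.
have [|t [_ Ft]] := cT (filter_from G id) FF; first by exists X0.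
exists t => X GX; apply: (Gcl _ GX) => U tU.
by apply: Ft => //; exists X.
Qed.

Context {R : realType} {T : topologicalType} {V : lmodType R}.
Hypothesis cT : compact [set: T].
Variable ev : T -> V -> R^o.
Hypothesis ev_lin : forall s, linear (ev s).
Hypothesis ev_cont : forall a, continuous (ev^~ a).
Variable C : set (V -> R^o).
Hypothesis C_lin : forall phi, C phi -> linear phi.

(* For [S] closed and [phi] linear, [dominated S phi] says that [phi] lies in the
   weak* closed convex hull of [ev @` S]. *)
Definition dominated (S : set T) (phi : V -> R^o) :=
  forall a, exists2 s, S s & phi a <= ev s a.

(** The functionals of [C] dominated by [S] form an extremal subset of [C], the analogue of a
    face. *)
Definition facial (S : set T) := forall phi psi (t : R), C phi -> C psi ->
  0 < t < 1 -> dominated S (t *: phi + (1 - t) *: psi) ->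
  dominated S phi /\ dominated S psi.

Definition argmax (S : set T) (b : V) :=
  [set s | S s /\ forall s', S s' -> ev s' b <= ev s b].

Let linB (f : V -> R^o) a b : linear f -> f (a - b) = f a - f b.
Proof. by move=> lf; rewrite addrC -scaleN1r lf scaleN1r addrC. Qed.
Let lin0 (f : V -> R^o) : linear f -> f 0 = 0.
Proof. by move=> lf; rewrite -(subrr 0) linB// subrr. Qed.
Let linN (f : V -> R^o) a : linear f -> f (- a) = - f a.
Proof. by move=> lf; rewrite -sub0r linB// lin0// sub0r. Qed.

Lemma closed_argmax S b : closed S -> closed (argmax S b).
Proof.
move=> Scl; rewrite (_ : argmax S b =
    S `&` \bigcap_(s' in S) [set s | ev s' b <= ev s b]); last first.
  by apply/seteqP; split => s [].
apply: closedI => //; apply: closed_bigI => s' _.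
by apply: (closed_comp _ (@closed_ge R (ev s' b))) => s _; exact: ev_cont.
Qed.

Lemma argmax_nonempty S b : closed S -> S !=set0 -> argmax S b !=set0.
Proof.
move=> Scl [s0 Ss0].
pose X s' := S `&` [set s | ev s' b <= ev s b].
have [||| t Xt] := @compact_chain _ (X @` S) s0 cT.
- move=> _ [s' _ <-]; apply: closedI => //.
  by apply: (closed_comp _ (@closed_ge R (ev s' b))) => s _; exact: ev_cont.
- by move=> _ [s' Ss' <-]; exists s'; split => /=.
- move=> _ _ [s Ss <-] [s' Ss' <-].
  have [le|/ltW le] := leP (ev s b) (ev s' b); [right|left] => z [Sz /= zs];
    by split => //=; exact: le_trans zs.
exists t; split; first by have [] := Xt _ (ex_intro2 _ _ s0 Ss0 erefl).
by move=> s' Ss'; have [] := Xt _ (ex_intro2 _ _ s' Ss' erefl).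
Qed.

(** A combination dominated by [argmax S b] reaches at [b] the maximum over [S], so both of its
    terms do. It remains to see that a functional dominated by [S] and reaching this maximum is
    dominated by [argmax S b]. *)
Lemma facial_argmax S b : closed S -> S !=set0 -> facial S -> facial (argmax S b).
Proof.
move=> Scl S0 Sf phi psi t Cphi Cpsi t01 dom.
have [t0 t1] := andP t01.
have domS : dominated S (t *: phi + (1 - t) *: psi).
  by move=> a; have [s [Ss _] sa] := dom a; exists s.
have [dphi dpsi] := Sf _ _ _ Cphi Cpsi t01 domS.
have [m [Sm mmax]] := argmax_nonempty b Scl S0.
have le_m f : dominated S f -> f b <= ev m b.
  by move=> /(_ b)[s Ss /le_trans]; apply; exact: mmax.
have mb : ev m b <= t * phi b + (1 - t) * psi b.
  have [s [Ss smax]] := dom (- b).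
  rewrite (linN b (ev_lin s)).
  rewrite [X in X <= _ -> _](_ : _ = t * phi (- b) + (1 - t) * psi (- b))//.
  rewrite (linN b (C_lin Cphi)) (linN b (C_lin Cpsi)).
  by have := smax _ Sm; lra.
have eqb f : f b <= ev m b -> ev m b <= f b -> f b = ev m b.
  by move=> h1 h2; apply/eqP; rewrite eq_le h1 h2.
suff H f : C f -> dominated S f -> f b = ev m b -> dominated (argmax S b) f.
  have := le_m _ dphi; have := le_m _ dpsi => h1 h2.
  split; apply: H => //; apply: eqb => //.
    rewrite -(ler_pM2l t0); have : (1 - t) * psi b <= (1 - t) * ev m b.
      by rewrite ler_wpM2l// subr_ge0 ltW.
    by lra.
  have t1' : 0 < 1 - t by rewrite subr_gt0.
  rewrite -(ler_pM2l t1'); have : t * phi b <= t * ev m b.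
    by rewrite ler_wpM2l// ltW.
  by lra.
move=> Cf df fb c.
(* Domination at [n%:R *: b + c] makes [X n] nonempty. A point common to all [X n] maximizes at [b],
   as [n] is arbitrarily large. *)
pose X (n : nat) := S `&` [set s | f c <= ev s c + n%:R * (ev s b - ev m b)].
have [||| s Xs] := @compact_chain _ (range X) m cT.
- move=> _ [n _ <-]; apply: closedI => //.
  pose g (s : T) : R^o := ev s c + n%:R *: (ev s b - ev m b).
  apply: (@closed_comp _ _ g _ _ (@closed_ge R (f c))) => s _.
  apply: cvgD; first exact: ev_cont.
  by apply: cvgZl_tmp; apply: cvgB; [exact: ev_cont|exact: cvg_cst].
- move=> _ [n _ <-]; have [s Ss] := df (n%:R *: b + c).
  rewrite (C_lin Cf) ev_lin fb /= => h; exists s; split=> //=.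
  move: h; rewrite /GRing.scale/=; lra.
- suff mono n p : (n <= p)%N -> X p `<=` X n.
    move=> _ _ [n _ <-] [p _ <-].
    by have [/mono|/ltnW/mono] := leqP n p; [right|left].
  move=> np s [Ss /= h]; split=> //=; rewrite (le_trans h)// lerD2l.
  by rewrite ler_wnM2r ?subr_le0 ?mmax// ler_nat.
have Ss : S s by have [] := Xs _ (ex_intro2 _ _ 0%N I erefl).
have h n : f c <= ev s c + n%:R * (ev s b - ev m b).
  by have [] := Xs _ (ex_intro2 _ _ n I erefl).
exists s; last by have := h 0%N; rewrite mul0r addr0.
split=> // s' Ss'; rewrite (le_trans (mmax _ Ss'))//.
rewrite leNgt; apply/negP => lt.
have d0 : 0 < ev m b - ev s b by rewrite subr_gt0.
have := h (Num.truncn ((ev s c - f c) / (ev m b - ev s b))).+1.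
rewrite leNgt => /negP; apply.
have := truncnS_gt ((ev s c - f c) / (ev m b - ev s b)).
by rewrite ltr_pdivrMr//; lra.
Qed.

(** Bounds for Zorn's lemma: by compactness, a functional dominated by all members of the chain is
    dominated by their intersection. *)
Lemma facial_chain (F : set (set T)) (x : T) : F !=set0 ->
  (forall S, F S -> [/\ closed S, S !=set0 & facial S]) -> total_on F subset ->
  [/\ closed (\bigcap_(S in F) S), (\bigcap_(S in F) S) !=set0 &
      facial (\bigcap_(S in F) S)].
Proof.
move=> F0 Fg Ftot; split.
- by apply: closed_bigI => S /Fg[].
- have [|||t Ft] := @compact_chain _ F x cT => //; last by exists t.
  + by move=> S /Fg[].
  + by move=> S /Fg[].
- move=> phi psi t Cphi Cpsi t01 dom.
  suff H f : (forall S, F S -> dominated S f) -> dominated (\bigcap_(S in F) S) f.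
    split; apply: H => S FS; have [_ _ Sf] := Fg _ FS;
      have [] // := Sf _ _ _ Cphi Cpsi t01 _;
      by move=> a; have [s Fs sa] := dom a; exists s => //; exact: Fs.
  move=> Ff a; pose X S := S `&` [set s | f a <= ev s a].
  have [|||s Xs] := @compact_chain _ (X @` F) x cT.
  + move=> _ [S /Fg[Scl _ _] <-]; apply: closedI => //.
    by apply: (closed_comp _ (@closed_ge R (f a))) => s _; exact: ev_cont.
  + by move=> _ [S FS <-]; have [s Ss sa] := Ff _ FS a; exists s.
  + move=> _ _ [S FS <-] [S' FS' <-].
    by have [SS'|SS'] := Ftot _ _ FS FS'; [left|right] => z [/SS' ? ?].
  exists s => [S FS|]; first by have [] := Xs _ (ex_intro2 _ _ S FS erefl).
  by have [S FS] := F0; have [] := Xs _ (ex_intro2 _ _ S FS erefl).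
Qed.

(* A minimal closed facial set equals all its [argmax]'s, so [ev] is constant on
   it, and its value there is extreme; this replaces the theorems of Krein-Milman
   and Milman. *)
Lemma extreme_argmax (a : V) (x : T) : (forall s, C (ev s)) ->
  (forall phi, C phi -> dominated setT phi) ->
  exists2 s, extreme_point C (ev s) & forall s', ev s' a <= ev s a.
Proof.
move=> Cev Cdom.
pose good S := [/\ closed S, S !=set0 & facial S].
have gT : good setT by split; [exact: closedT|exists x|move=> ? ? ? /Cdom ? /Cdom].
have gA S b : good S -> good (argmax S b).
  move=> [Scl S0 Sf]; split; [exact: closed_argmax|exact: argmax_nonempty|].
  exact: facial_argmax.
pose S0 := argmax setT a.
have gS0 : good S0 by exact: gA.
(* Zorn's lemma for unions is applied to the parts removed from [S0]; a maximal [A] leaves a minimal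
   good set. *)
have [|A [gSA Amax]] := @Zorn_bigcup T [set X | good (S0 `\` X)].
  move=> F Fg Ftot /=; have [->|/set0P[X0 FX0]] := eqVneq F set0.
    by rewrite bigcup_set0 setD0.
  pose F' := [set S0 `\` X | X in F].
  have -> : S0 `\` \bigcup_(X in F) X = \bigcap_(S in F') S.
    apply/seteqP; split=> [s [Ss nF] _ [X FX <-]|s Fs].
      by split=> // Xs; apply: nF; exists X.
    split; first by have [] := Fs _ (ex_intro2 _ _ X0 FX0 erefl).
    by move=> [X FX Xs]; have [] := Fs _ (ex_intro2 _ _ X FX erefl).
  apply: facial_chain => //.
  - by exists (S0 `\` X0), X0.
  - by move=> _ [X /Fg + <-].
  - move=> _ _ [X FX <-] [Y FY <-].
    by have [XY|YX] := Ftot _ _ FX FY; [right|left]; exact: setDS.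
set S := S0 `\` A in gSA.
have Smin b s : S s -> argmax S b s.
  move=> Ss; apply: contrapT => ns.
  apply: (Amax (A `|` ~` argmax S b)); last first.
    rewrite /= setDE setCU setCK setIA -setDE.
    have -> : S `&` argmax S b = argmax S b by apply/setIidr => z [].
    exact: gA.
  split; first exact: subsetUl.
  by move=> /(_ s (or_intror ns)); case: Ss.
have [_ [s Ss] Sf] := gSA.
(* [ev] is constant on [S], so testing on [b] and [- b] identifies any functional of [C] dominated
   by [S]. *)
have SP phi : C phi -> dominated S phi -> phi = ev s.
  move=> Cphi dphi.
  have le b : phi b <= ev s b.
    have [s' Ss' /le_trans] := dphi b; apply.
    by have [_ /(_ _ Ss')] := Smin b _ Ss.
  apply/funext => b; apply/eqP; rewrite eq_le le/=.
  have := le (- b); rewrite (linN b (ev_lin s)) (linN b (C_lin Cphi)).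
  by rewrite lerN2.
exists s; last by move=> s'; case: Ss => -[_ + _]; exact.
split=> [|y z t Cy Cz t01 e]; first exact: Cev.
have [|dy dz] := Sf _ _ _ Cy Cz t01; last by split; exact: SP.
by rewrite -e => b; exists s.
Qed.

End choquet.

(** * Norms attained on the Choquet boundary *)

Section choquet_boundary.
Context {R : realType} {K : compactHausdorffType} {E : normedModType R}.
Variable H : submodClosed (cfun R K E).
Local Notation A := (canonical_space H).

(** Evaluations are taken with both signs, so that maximizing them maximizes the modulus. The sign
    of the extreme one is removed by symmetry of the dual ball. *)
Lemma choquet_norm_attained (a : cfun R K R^o) (y0 : K) : a \in A ->
  exists2 x, choquet_boundary H x & forall y, `|a y| <= `|a x|.
Proof.
move=> Aa; pose V := submod A; pose v0 : V := Submod Aa.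
pose ev (s : K * bool) (v : V) : R^o := (-1) ^+ s.2 * val v s.1.
have ev_lin s : linear (ev s).
  move=> r u v; rewrite /ev linearP /= mulrDr /GRing.scale/=; congr (_ + _).
  by rewrite !mulrA (mulrC r).
have ev_cont v : continuous (ev^~ v).
  move=> [x b]; apply: cvgM.
    have sgc : continuous (fun c : bool => (-1) ^+ c : R).
      move=> c U /nbhs_singleton Uc; apply: open_nbhs_nbhs.
      by split; first exact: discrete_open.
    apply: (@cvg_comp _ _ _ snd (fun c : bool => (-1) ^+ c : R) _ (nbhs b)).
      exact: cvg_snd.
    exact: sgc.
  apply: (@cvg_comp _ _ _ fst (val v) _ (nbhs x)); first exact: cvg_fst.
  exact: cts_fun.
have cT : compact [set: K * bool].
  rewrite -setXTT; apply: compact_setX; [exact: compact_setT|exact: bool_compact].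
pose C := dual_unit_ball V.
have Cev s : C (ev s).
  apply/dual_unit_ballP; split=> // v.
  rewrite /ev normrM normrX normrN1 expr1n mul1r.
  exact: (sup_norm_ub s.1 (cfun_bounded (val v))).
have Clin phi : C phi -> linear phi by case.
have Cdom phi : C phi -> dominated ev setT phi.
  move=> /dual_unit_ballP[_ phi1] v.
  have [s [_ smax]] := @argmax_nonempty _ _ _ cT ev ev_cont setT v
    (@closedT _) (ex_intro _ (y0, true) I).
  exists s => //; rewrite (le_trans (ler_norm _))// (le_trans (phi1 v))//.
  apply: sup_norm_le => [|x].
    (* Comparison with the opposite sign shows that the maximum is nonnegative. *)
    have := smax (s.1, ~~ s.2) I; rewrite /ev /= signrN.
    by rewrite mulNr; lra.
  have := smax (x, val v x < 0) I; rewrite /ev/=.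
  by rewrite -normrEsign.
have [s sext smax] := extreme_argmax cT ev_lin ev_cont Clin v0 (y0, true) Cev Cdom.
exists s.1; last first.
  move=> y; have := smax (y, a y < 0); rewrite /ev /= -normrEsign => /le_trans; apply.
  by rewrite (le_trans (ler_norm _))// normrM normrX normrN1 expr1n mul1r.
have evE : ev s = (-1) ^+ s.2 *: @evaluation _ _ _ H s.1 by [].
rewrite /choquet_boundary /=.
have CN phi : C phi -> C (- phi).
  move=> /dual_unit_ballP[lphi phi1]; apply/dual_unit_ballP; split=> [r u v|v].
    by rewrite /= !fctE lphi scalerN opprD.
  by rewrite fctE normrN.
move: evE; case: s.2 => /=; last first.
  by rewrite expr0 scale1r => <-.
rewrite expr1 scaleN1r => evE; have {evE}-> : @evaluation _ _ _ H s.1 = - ev s.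
  by rewrite evE opprK.
split=> [|y z t Cy Cz t01 e]; first exact: CN.
have [_ /(_ (- y) (- z) t (CN _ Cy) (CN _ Cz) t01)[]] := sext.
  by rewrite -[LHS]opprK e !scalerN opprD.
by move=> /(congr1 -%R); rewrite opprK => -> /(congr1 -%R); rewrite opprK.
Qed.

Lemma choquet_norm (h : cfun R K E) (y : K) : h \in H ->
  exists2 x, choquet_boundary H x & `|h y| <= `|h x|.
Proof.
move=> Hh; have [phi phi1 phih] := hahn_banach_norming (h y).
have phic : continuous phi.
  by apply: (@linear_le_norm_continuous _ _ _ _ 1) => v; rewrite mul1r.
have ac : continuous (fun x => phi (h x) : R^o).
  by move=> x; apply: continuous_comp; [exact: cts_fun|exact: phic].
pose a : cfun R K R^o := cfun_of ac.
have Aa : a \in A.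
  apply/mem_set/subset_closure; exists [:: (1, a)].
    by move=> p; rewrite inE => /eqP-> /=; exists phi, h.
  by rewrite big_seq1 scale1r.
have [x Chx /(_ y) xmax] := choquet_norm_attained y Aa.
exists x => //; rewrite -phih (le_trans (ler_norm _))// (le_trans xmax)//.
exact: phi1.
Qed.

(** A neighbourhood of [x] missing the Choquet boundary would yield a function above 1/2 at [x] but
    below 1/2 on the Choquet boundary, where its norm is attained. *)
Lemma weak_peak_closure : weak_peak_points H `<=` closure (choquet_boundary H).
Proof.
move=> x Wx U Ux; apply: contrapT => /set0P/negP/negPn/eqP ChU.
have [|a [[Aa _] a01 ax aCh]] := Wx U 2^-1 Ux; first by apply/andP; split; lra.
have [y Chy /(_ x) yx] := choquet_norm_attained x Aa.
have : a y < 2^-1.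
  by apply: aCh => // Uy; have : (choquet_boundary H `&` U) y by []; rewrite ChU.
have /andP[ay _] := a01 y; have /andP[ax0 _] := a01 x.
by move: yx; rewrite !ger0_norm//; lra.
Qed.

End choquet_boundary.

(** * Derived sets *)

Section derived_sets.

Lemma derived_set_sub (T : topologicalType) (S : set T) j : derived_set S j `<=` S.
Proof. by elim: j => // j IHj x [/IHj]. Qed.

Lemma derived_setS (T : topologicalType) (S S' : set T) j :
  S `<=` S' -> derived_set S j `<=` derived_set S' j.
Proof.
move=> SS'; elim: j => // j IHj x [Sx lx]; split; first exact: IHj.
by move=> U /lx[y [yx Sy Uy]]; exists y; split=> //; exact: IHj.
Qed.

Lemma derived_set0 (T : topologicalType) j : derived_set (@set0 T) j = set0.
Proof. by apply/seteqP; split=> // x /derived_set_sub. Qed.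

(** [x] is a limit point of all earlier derived sets too; closedness puts it into [S], and induction
    into each of them. *)
Lemma closed_limit_point_derived_set (T : topologicalType) (S : set T) j x :
  closed S -> limit_point (derived_set S j) x -> derived_set S j.+1 x.
Proof.
move=> Scl lx.
have lS i : (i <= j)%N -> limit_point (derived_set S i) x.
  move=> ij U /lx[y [yx Sy Uy]]; exists y; split=> //.
  move: Sy; rewrite -(subnK ij).
  by rewrite /derived_set iterD => /derived_set_sub.
suff Sx i : (i <= j)%N -> derived_set S i x by split; [exact: Sx|exact: lx].
elim: i => [_|i IHi ij]; last by split; [exact/IHi/ltnW|exact/lS/ltnW].
by apply: Scl => U /(lS 0%N isT)[y [_ Sy Uy]]; exists y.
Qed.

Lemma derived_setU (T : topologicalType) (S S' : set T) j : closed S -> closed S' ->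
  derived_set (S `|` S') j `<=` derived_set S j `|` derived_set S' j.
Proof.
move=> Scl Scl'; elim: j => // j IHj x [_ lx].
suff [lp|lp] : limit_point (derived_set S j) x \/ limit_point (derived_set S' j) x.
  by left; exact: closed_limit_point_derived_set.
  by right; exact: closed_limit_point_derived_set.
apply: contrapT => /not_orP[/existsNP[U /not_implyP[Ux nU]]
  /existsNP[U' /not_implyP[Ux' nU']]].
have [y [yx /IHj[Sy|Sy] [Uy Uy']]] := lx _ (filterI Ux Ux').
  by apply: nU; exists y.
by apply: nU'; exists y.
Qed.

Context {K : compactHausdorffType}.
Implicit Types S : set K.

(** The filter of sets containing all but finitely many points of [S] has a cluster point. *)
Lemma infinite_limit_point S : infinite_set S -> exists z, limit_point S z.
Proof.
move=> Sinf.
pose F : set_system K := [set Y | finite_set (S `\` Y)].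
have FF : ProperFilter F.
  split; first by rewrite /F /= setD0.
  split; first by rewrite /F /= setDT; exact: finite_set0.
    by move=> X Y FX FY; rewrite /F/= setDIr finite_setU.
  by move=> X Y XY; apply: sub_finite_set; exact: setDS.
have [|z [_ Fz]] := @compact_setT K F FF; first by rewrite /F /= setDT.
exists z => U Uz.
have Sz : F (S `\ z).
  rewrite /F /= setDDr setDv set0U; apply: sub_finite_set (finite_set1 z).
  exact: subIsetr.
have [y [[Sy yz] Uy]] := Fz _ _ Sz Uz.
by exists y; split=> //; apply/eqP.
Qed.

Lemma finite_derived_set S j : closed S -> derived_set S j.+1 = set0 ->
  finite_set (derived_set S j).
Proof.
move=> Scl S0; apply: contrapT => /infinite_limit_point[z lz].
have := closed_limit_point_derived_set Scl lz; by rewrite S0.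
Qed.

Lemma disjoint_nbhs (x y : K) : x != y -> exists P : set K * set K,
  [/\ nbhs x P.1, nbhs y P.2 & forall z, P.1 z -> P.2 z -> False].
Proof.
move=> xy; have := @hausdorff_setT K; rewrite open_hausdorff.
move=> /(_ _ _ xy)[P [/set_mem Px /set_mem Py] [oP1 oP2 P0]]; exists P; split.
- by apply: open_nbhs_nbhs.
- by apply: open_nbhs_nbhs.
- by move=> z P1 P2; have : (P.1 `&` P.2) z by []; rewrite (eqP P0).
Qed.

(** A point of [S] other than [z] is separated from [z], and the choice is repeated inside the part
    around [z]. *)
Lemma limit_point_disjoint_nbhs S (U : set K) (z : K) : limit_point S z ->
  nbhs z U -> exists (x : nat -> K) (V : nat -> set K),
  [/\ forall n, S (x n), forall n, nbhs (x n) (V n), forall n, V n `<=` U &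
      forall m n t, V m t -> V n t -> m = n].
Proof.
move=> lz Uz.
have /choice[f Hf] (Y : set K) : exists p : K * set K * set K, nbhs z Y ->
    [/\ [/\ S p.1.1, nbhs p.1.1 p.1.2 & p.1.2 `<=` Y], nbhs z p.2, p.2 `<=` Y &
        forall t, p.1.2 t -> p.2 t -> False].
  have [Yz|] := pselect (nbhs z Y); last by exists (z, set0, set0).
  have [O [oO Oz] OY] : exists2 O, open_nbhs z O & O `<=` Y.
    by move: Yz; rewrite nbhsE.
  have [y [yz Sy Oy]] := lz O (open_nbhs_nbhs (conj oO Oz)).
  have [P [Py Pz PP]] := disjoint_nbhs yz.
  exists (y, P.1 `&` O, P.2 `&` O) => _; split=> /=.
  - split=> //; last by move=> t [_ /OY].
    by apply: filterI => //; exact: (open_nbhs_nbhs (conj oO Oy)).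
  - by apply: filterI => //; exact: (open_nbhs_nbhs (conj oO Oz)).
  - by move=> t [_ /OY].
  - by move=> t [? _] [? _]; exact: (PP t).
pose Y n := iter n (fun Z => (f Z).2) U.
have Yz n : nbhs z (Y n) by elim: n => //= n IHn; have [] := Hf _ IHn.
have Ydec m n : (m <= n)%N -> Y n `<=` Y m.
  move=> /subnK <-; elim: (n - m)%N => // p IHp.
  by rewrite addSn => t /= Yt; apply: IHp; have [_ _ + _] := Hf _ (Yz (p + m)%N); exact.
exists (fun n => (f (Y n)).1.1), (fun n => (f (Y n)).1.2); split.
- by move=> n; have [[]] := Hf _ (Yz n).
- by move=> n; have [[]] := Hf _ (Yz n).
- by move=> n t Vt; apply: (Ydec 0%N n) => //; have [[_ _ +] _ _ _] := Hf _ (Yz n); exact.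
- have lt m n t : (m < n)%N -> (f (Y m)).1.2 t -> (f (Y n)).1.2 t -> False.
    move=> mn Vm Vn; have [_ _ _ +] := Hf _ (Yz m); move=> /(_ t Vm); apply.
    by apply: (Ydec m.+1 n) => //; have [[_ _ +] _ _ _] := Hf _ (Yz n); exact.
  by move=> m n t Vm Vn; have [/lt/(_ Vm Vn)|/lt/(_ Vn Vm)|] := ltngtP m n.
Qed.

Lemma finite_disjoint_nbhs n (w : 'I_n -> K) : injective w ->
  exists V : 'I_n -> set K, (forall i, nbhs (w i) (V i)) /\
    forall i j t, V i t -> V j t -> i = j.
Proof.
move=> winj.
have /choice[P HP] (p : 'I_n * 'I_n) : exists Q : set K * set K, p.1 != p.2 ->
    [/\ nbhs (w p.1) Q.1, nbhs (w p.2) Q.2 & forall z, Q.1 z -> Q.2 z -> False].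
  have [e|/negP ne] := pselect (p.1 == p.2).
    by exists (set0, set0) => /negP/(_ e).
  have wne : w p.1 != w p.2 by apply: contra_neq ne => /winj.
  have [Q HQ] := disjoint_nbhs wne.
  by exists Q.
(* Both ordered pairs are used, so that [V i] and [V j] lie on opposite sides of the separation
   chosen for [(i, j)]. *)
exists (fun i => [set t | forall j, i != j -> (P (i, j)).1 t /\ (P (j, i)).2 t]).
split=> [i|i j t Vi Vj].
  apply: (@filter_forall _ _ (fun j t => i != j -> (P (i, j)).1 t /\ (P (j, i)).2 t)).
  move=> j; have [e|ne] := pselect (i == j).
    by apply: filterE => t /negP/(_ e).
  have ij : i != j by exact/negP.
  have [h1 _ _] := HP (i, j) ij; have [|_ h2 _] := HP (j, i); first by rewrite /= eq_sym.
  by apply: filterS2 h1 h2.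
apply/eqP; apply: contrapT => /negP ij.
have [_ _ /(_ t)] := HP (i, j) ij; apply; first by have [] := Vi _ ij.
by rewrite eq_sym in ij; have [] := Vj _ ij.
Qed.

End derived_sets.

(** * Chains of peak functions *)

Section finite_sums.
Context {R : realType}.

Lemma sum_delta (p n : nat) : \sum_(j < n) (j == p :> nat)%:R = (p < n)%:R :> R.
Proof.
elim: n => [|n IHn]; first by rewrite big_ord0.
rewrite big_ord_recr/= IHn [in RHS]ltnS [(p <= n)%N]leq_eqVlt (eq_sym p).
by case: eqVneq => [->|_]; rewrite ?ltnn ?add0r ?addr0.
Qed.

Lemma sum_deltaZ (V : lmodType R) (a : nat -> V) (p n : nat) : (p < n)%N ->
  \sum_(j < n) (j == p :> nat)%:R *: a j = a p.
Proof.
move=> pn; rewrite (bigD1 (Ordinal pn))//= eqxx scale1r big1 ?addr0// => j jp.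
by rewrite -val_eqE/= in jp; rewrite (negbTE jp) scale0r.
Qed.

Lemma sum_geometric_half n : \sum_(j < n) (2^-1 : R) ^+ j.+1 = 1 - 2^-1 ^+ n.
Proof.
elim: n => [|n IHn]; first by rewrite big_ord0 expr0 subrr.
by rewrite big_ord_recr/= IHn exprS; lra.
Qed.

Lemma sum_uniq_le (f : nat -> R) (s : seq nat) : (forall n, 0 <= f n) -> uniq s ->
  exists n, \sum_(j <- s) f j <= \sum_(j < n) f j.
Proof.
move=> f0 us; have [N sN] : exists N, forall j, j \in s -> (j < N)%N.
  by exists (\max_(j <- s) j).+1 => j js; rewrite ltnS leq_bigmax_seq.
exists N.
have ps : perm_eq s [seq j <- index_iota 0 N | j \in s].
  apply: uniq_perm => //; first by rewrite filter_uniq// iota_uniq.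
  by move=> j; rewrite mem_filter mem_index_iota /=; case: (boolP (j \in s)) => // /sN ->.
rewrite (perm_big _ ps)/= big_filter big_mkcond/= -(big_mkord predT f).
by apply: ler_sum => j _; case: ifP.
Qed.

Variable V : normedModType R.

(* [J = [set j | eps <= `|a j|]] has at most [k] elements. Testing [a] on the
   coefficients [1] at some [i] outside [J] and [-2] at [j > i] shows that
   [2 * `|a j|] is nearly at most [Q] whenever some [i < j] is outside [J]. *)
Lemma few_large_terms (a : nat -> V) (k l : nat) (Q eps : R) :
  (0 < k <= l)%N -> 0 <= Q -> 0 < eps ->
  (forall c : nat -> R, (forall i, (i <= l)%N -> `|\sum_(j < i.+1) c j| <= 1) ->
    `|\sum_(j < l.+1) c j *: a j| <= Q) ->
  (\sum_(j < l.+1) (eps <= `|a j|)%R <= k)%N ->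
  `|\sum_(j < l.+1) (if (j < k)%N then 1 else 2) *: a j| <=
     k%:R * (Q + eps) + 2 * l.+1%:R * eps /\
  `|a 0%N + 2 *: a l| <= Q + 2 * eps.
Proof.
move=> /andP[k0 kl] Q0 eps0 aQ acount.
have a1 p : (p <= l)%N -> `|a p| <= Q.
  move=> pl; have := aQ (fun j => (j == p)%:R).
  rewrite sum_deltaZ//; apply=> i _; rewrite sum_delta.
  by case: (p < i.+1)%N; rewrite ?normr1 ?normr0.
(* The coefficients [1, -2] have partial sums [1, -1]; those of [a3], [1, -2, 2], have
   [1, -1, 1]. *)
have a2 p q : (p < q)%N -> (q <= l)%N -> `|a p - 2 *: a q| <= Q.
  move=> pq ql; have := aQ (fun j => (j == p)%:R - 2 * (j == q)%:R).
  under eq_bigr do rewrite scalerBl -scalerA.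
  rewrite sumrB -scaler_sumr !sum_deltaZ//; last by rewrite ltnS ltnW// (leq_trans pq).
  apply=> i _; rewrite sumrB -mulr_sumr !sum_delta.
  have [qi|qi] := ltnP q i.+1.
    by rewrite (ltn_trans pq qi) ler_norml /= mulr1n; apply/andP; split; lra.
  by case: (p < i.+1)%N; rewrite ler_norml /= ?mulr1n ?mulr0n; apply/andP; split; lra.
have a3 p q : (0 < p)%N -> (p < q)%N -> (q <= l)%N ->
    `|a 0%N - 2 *: a p + 2 *: a q| <= Q.
  move=> p0 pq ql; have := aQ (fun j => (j == 0)%:R - 2 * (j == p)%:R + 2 * (j == q)%:R).
  under eq_bigr do rewrite scalerDl scalerBl -!scalerA.
  rewrite big_split sumrB -!scaler_sumr !sum_deltaZ//.
    2: by rewrite ltnS ltnW// (leq_trans pq).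
  apply=> i _; rewrite big_split sumrB -!mulr_sumr !sum_delta.
  have [qi|qi] := ltnP q i.+1.
    by rewrite (ltn_trans pq qi) ler_norml /= mulr1n; apply/andP; split; lra.
  by case: (p < i.+1)%N; rewrite ler_norml /= ?mulr1n ?mulr0n; apply/andP; split; lra.
(* Otherwise the [j + 1] entries up to [j], more than [k], would all be large. *)
have small j : (k <= j)%N -> (j <= l)%N -> eps <= `|a j| ->
    exists2 i, (i < j)%N & `|a i| < eps.
  move=> kj jl ja; apply: contrapT => /forall2NP H.
  move: acount; rewrite leqNgt => /negP; apply.
  apply: (@leq_trans j.+1); first by rewrite ltnS.
  rewrite -(subnKC jl) -addSn big_split_ord/= (leq_trans _ (leq_addr _ _))//.
  rewrite -[leqLHS]card_ord -sum1_card; apply: leq_sum => i _ /=.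
  have [ij|ji] := ltnP i j; last first.
    suff -> : i = j :> nat by rewrite ja.
    by apply/eqP; rewrite eqn_leq ji -ltnS ltn_ord.
  by have [/(_ ij)|/negP] := H i; rewrite -?leNgt// => ->.
split; last first.
  (* Inserting [-2] times the small entry [a i] between 0 and [l] restores alternating signs; if [i]
     is 0 or [l], that end is itself negligible. *)
  have [i il ai] : exists2 i, (i <= l)%N & `|a i| < eps.
    have [al|al] := ltP `|a l| eps; first by exists l.
    by have [i il ai] := small l kl (leqnn _) al; exists i => //; exact: ltnW.
  have l0 : (0 < l)%N := leq_trans k0 kl.
  have n2 (v : V) : `|2 *: v| = 2 * `|v| by rewrite normrZ gtr0_norm.
  have [i0|i0] := posnP i.
    rewrite i0 in ai; have := a2 0%N l l0 (leqnn _).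
    rewrite -(normrN (_ - _)) opprB => h.
    have -> : a 0%N + 2 *: a l = (2 *: a l - a 0%N) + 2 *: a 0%N.
      by rewrite (scaler_nat 2 (a 0%N)) mulr2n addrA subrK addrC.
    by rewrite (le_trans (ler_normD _ _))// lerD// n2; lra.
  have [li|li] := leqP l i.
    have -> : l = i by apply/eqP; rewrite eqn_leq li.
    rewrite (le_trans (ler_normD _ _))// lerD ?a1// n2; lra.
  have -> : a 0%N + 2 *: a l = (a 0%N - 2 *: a i + 2 *: a l) + 2 *: a i.
    by rewrite addrAC subrK.
  rewrite (le_trans (ler_normD _ _))// lerD ?a3// n2; lra.
apply: (le_trans (ler_norm_sum _ _ _)).
(* A large entry costs about [Q] even with weight 2: for [k <= j] some small entry precedes it and
   [a2] applies. *)
have term (j : 'I_l.+1) : `|(if (j < k)%N then 1 else 2) *: a j| <=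
    (eps <= `|a j|)%R%:R * (Q + eps) + 2 * eps.
  have jl : (j <= l)%N by rewrite -ltnS.
  have n2 (v : V) : `|2 *: v| = 2 * `|v| by rewrite normrZ gtr0_norm.
  have [aj|aj] := leP eps `|a j|; last first.
    by case: ifP => _; rewrite /= ?n2 ?scale1r mul0r; lra.
  rewrite mul1r; case: ifP => [_|/negbT]; first by rewrite scale1r; have := a1 j jl; lra.
  rewrite -leqNgt => kj; have [i ij ai] := small j kj jl aj.
  have := ler_normB (a i - 2 *: a j) (a i); rewrite addrAC subrr add0r normrN.
  by have := a2 i j ij jl; lra.
apply: (le_trans (ler_sum _ (fun j _ => term j))).
rewrite big_split/= -mulr_suml -natr_sum sumr_const card_ord.
have -> : 2 * eps *+ l.+1 = 2 * l.+1%:R * eps by rewrite -mulr_natr mulrAC.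
rewrite lerD2r ler_wpM2r ?ler_nat//; lra.
Qed.

End finite_sums.

(** * Series in a space without copies of c_0 *)

Section unconditionally_converging.
Context {R : realType} {E : completeNormedModType R}.

(** Infinitely many terms of norm at least [d] would form a subsequence to which
    [bessaga_pelczynski] applies. *)
Lemma no_c0_finite (z : nat -> E) (M d : R) : ~ contains_isomorphic_copy E (c0 R) ->
  0 < d ->
  (forall (phi : {linear E -> R^o}) n, (forall v, `|phi v| <= `|v|) ->
    \sum_(j < n) `|phi (z j)| <= M) ->
  finite_set [set n | d <= `|z n|].
Proof.
move=> Ec0 d0 zM; apply: contrapT => /infiniteP /pcard_leP[f].
apply: Ec0; apply: (@bessaga_pelczynski _ _ (z \o f) M d d0) => [n|phi s phi1 us].
  exact: (@funS _ _ _ _ f n I).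
have finj : injective f by move=> x y; apply: inj; rewrite inE.
have ufs : uniq (map f s) by rewrite map_inj_uniq.
have [|n] := @sum_uniq_le _ (fun j => `|phi (z j)|) (map f s) _ ufs => //.
by rewrite big_map => /le_trans; apply; exact: zM.
Qed.

End unconditionally_converging.

Lemma val_sum (R : realType) (K : compactHausdorffType) (E : normedModType R)
    (H : submodClosed (cfun R K E)) (I : finType) (h : I -> submod H) x :
  val (\sum_i h i) x = \sum_i val (h i) x.
Proof. exact: (big_morph (fun f : submod H => val f x)). Qed.

Lemma val_sumZ (R : realType) (K : compactHausdorffType) (E : normedModType R)
    (H : submodClosed (cfun R K E)) n (c : nat -> R) (h : nat -> submod H) x :
  val (\sum_(j < n) c j *: h j) x = \sum_(j < n) c j *: val (h j) x.
Proof. exact: val_sum. Qed.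

Lemma norm_val_le (R : realType) (K : compactHausdorffType) (E : normedModType R)
    (H : submodClosed (cfun R K E)) (h : submod H) x : `|val h x| <= `|h|.
Proof. exact: (sup_norm_ub x (cfun_bounded (val h))). Qed.

(** * Peak functions with small images *)

Section peaks.
Context {R : realType} {K1 K2 : compactHausdorffType}.
Context {E1 : normedModType R} {E2 : completeNormedModType R}.
Context {H1 : submodClosed (cfun R K1 E1)} {H2 : submodClosed (cfun R K2 E2)}.

Lemma norm_le_choquet (h : submod H1) (M : R) : 0 <= M ->
  (forall x, choquet_boundary H1 x -> `|val h x| <= M) -> `|h| <= M.
Proof.
move=> M0 hM; apply: sup_norm_le => // y.
by have [x /hM xM /le_trans] := choquet_norm y (valP h); apply.
Qed.

Variable T : {linear submod H1 -> submod H2}.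

Lemma val_linear_sumZ n (c : nat -> R) (h : nat -> submod H1) y :
  val (T (\sum_(j < n) c j *: h j)) y = \sum_(j < n) c j *: val (T (h j)) y.
Proof.
have -> : T (\sum_(j < n) c j *: h j) = \sum_(j < n) c j *: T (h j).
  by rewrite linear_sum; apply: eq_bigr => j _; rewrite linearZ.
exact: val_sumZ (fun j => T (h j)) y.
Qed.

Variable L : R.
Hypothesis TL : forall h, `|T h| <= L * `|h|.
Hypothesis L0 : 0 <= L.

(** Signs turn a sum of moduli into the image of one combination of the [h j]. At a point of the
    Choquet boundary at most one [g j] escapes the geometric bounds, so this combination has norm at
    most twice that of [e]. *)
Lemma disjoint_peaks_image_small (g : nat -> cfun R K1 R^o) (V : nat -> set K1)
    (h : nat -> submod H1) (e : E1) (y : K2) (d : R) :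
  ~ contains_isomorphic_copy E2 (c0 R) -> 0 < d ->
  (forall n x, 0 <= g n x <= 1) ->
  (forall n x, choquet_boundary H1 x -> ~ V n x -> g n x < 2^-1 ^+ n.+1) ->
  (forall m n t, V m t -> V n t -> m = n) ->
  (forall n, val (h n) = tensor (g n) e) ->
  finite_set [set n | d <= `|val (T (h n)) y|].
Proof.
move=> E2c0 d0 g01 gV Vdisj hE.
apply: (@no_c0_finite _ _ (fun n => val (T (h n)) y) (L * (2 * `|e|))) => //.
move=> phi n phi1.
pose c j := Num.sg (phi (val (T (h j)) y)).
have c1 j : `|c j| <= 1 by rewrite normr_sg lern1 leq_b1.
have -> : \sum_(j < n) `|phi (val (T (h j)) y)| =
    phi (val (T (\sum_(j < n) c j *: h j)) y).
  rewrite val_linear_sumZ linear_sum; apply: eq_bigr => j _.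
  by rewrite linearZ normrEsg.
rewrite (le_trans (ler_norm _))// (le_trans (phi1 _))//.
rewrite (le_trans (norm_val_le _ _))// (le_trans (TL _))// ler_wpM2l//.
apply: norm_le_choquet => [|x Chx]; first by rewrite mulr_ge0.
rewrite val_sumZ (le_trans (ler_norm_sum _ _ _))//.
have gle : \sum_(j < n) g j x <= 2.
  have [[m Vm]|/forallNP nV] := pselect (exists m, V m x).
    rewrite (@le_trans _ _ (\sum_(j < n) ((j == m :> nat)%:R + 2^-1 ^+ j.+1)))//.
      apply: ler_sum => j _; have [->|jm] := eqVneq (j : nat) m.
        by have /andP[_ h1] := g01 m x; rewrite (le_trans h1)// lerDl exprn_ge0.
      rewrite add0r ltW// gV// => Vj.
      by move: jm; rewrite (Vdisj _ _ _ Vj Vm) eqxx.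
    rewrite big_split/= sum_delta sum_geometric_half.
    have : (m < n)%N%:R <= 1 :> R by case: (m < n)%N.
    have : 0 <= 2^-1 ^+ n :> R by rewrite exprn_ge0.
    by lra.
  rewrite (@le_trans _ _ (\sum_(j < n) 2^-1 ^+ j.+1))//.
    by apply: ler_sum => j _; rewrite ltW// gV.
  rewrite sum_geometric_half.
  have : 0 <= 2^-1 ^+ n :> R by rewrite exprn_ge0.
  by lra.
rewrite (@le_trans _ _ ((\sum_(j < n) g j x) * `|e|))//; last by rewrite ler_wpM2r.
rewrite mulr_suml; apply: ler_sum => j _; rewrite normrZ hE /= normrZ.
have /andP[g0 _] := g01 j x.
by rewrite [X in _ * (X * _)]ger0_norm// -[leRHS]mul1r ler_wpM2r// mulr_ge0.
Qed.

(** Disjoint peaks accumulate at [z], and each point of the finite [Y] excludes only finitely many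
    of them. *)
Lemma peak_selection (S U : set K1) (z : K1) (e : E1) (eps d : R) (Y : set K2) :
  ~ contains_isomorphic_copy E2 (c0 R) -> 0 < eps < 1 -> 0 < d ->
  S `<=` weak_peak_points H1 -> limit_point S z -> nbhs z U -> finite_set Y ->
  exists (x : K1) (g : cfun R K1 R^o) (h : submod H1),
    [/\ S x /\ nbhs x U, val h = tensor g e,
        (forall t, 0 <= g t <= 1) /\ 1 - eps < g x,
        forall t, choquet_boundary H1 t -> ~ U t -> g t < eps &
        forall y, Y y -> `|val (T h) y| < d].
Proof.
move=> E2c0 /andP[eps0 eps1] d0 SW Sz Uz Yfin.
have [x [V [Sx Vx VU Vdisj]]] := limit_point_disjoint_nbhs Sz Uz.
(* [eps] is the tolerance asked for; the powers of 1/2 make the peaks summable off their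
   neighbourhoods. *)
pose r n : R := Num.min eps (2^-1 ^+ n.+1).
have r01 n : 0 < r n < 1.
  apply/andP; split; first by rewrite /r lt_min eps0 exprn_gt0.
  by rewrite /r gt_min eps1.
have /choice[g Hg] n : exists g : cfun R K1 R^o,
    [/\ canonical_space_tensor H1 g, forall y, 0 <= g y <= 1, 1 - r n < g (x n) &
        forall y, choquet_boundary H1 y -> ~ V n y -> g y < r n].
  by have [g] := SW _ (Sx n) (V n) (r n) (Vx n) (r01 n); exists g.
have gH n : tensor (g n) e \in H1 by have [[_ +] _ _ _] := Hg n; exact.
pose h n : submod H1 := Submod (gH n).
have fin y : finite_set [set n | d <= `|val (T (h n)) y|].
  apply: (@disjoint_peaks_image_small g V h e) => //.
  - by move=> n t; have [] := Hg n.
  - move=> n t Ct Vt; have [_ _ _ /(_ _ Ct Vt)/lt_le_trans] := Hg n; apply.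
    by rewrite /r ge_min lexx orbT.
have [n nY] : exists n, forall y, Y y -> `|val (T (h n)) y| < d.
  apply: contrapT => /forallNP H; apply: infinite_nat.
  apply: (@sub_finite_set _ _ (\bigcup_(y in Y) [set n | d <= `|val (T (h n)) y|])).
    move=> n _; have /existsNP[y /not_implyP[Yy /negP]] := H n.
    by rewrite -leNgt; exists y.
  exact: bigcup_finite.
have [_ g01 gx gV] := Hg n.
have re : r n <= eps by rewrite /r ge_min lexx.
exists (x n), (g n), (h n); split=> //.
- by split=> //; apply: filterS (Vx n); exact: VU.
- by split=> //; rewrite (le_lt_trans _ gx)// lerD2l lerN2.
- by move=> t Ct Ut; rewrite (lt_le_trans _ re)// gV// => /VU.
Qed.

End peaks.

(** * Chains and the derived sets of their level sets *)

Section chains.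
Context {R : realType} {K1 K2 : compactHausdorffType}.
Context {E1 : normedModType R} {E2 : completeNormedModType R}.
Context {H1 : submodClosed (cfun R K1 E1)} {H2 : submodClosed (cfun R K2 E2)}.
Hypothesis E2_c0 : ~ contains_isomorphic_copy E2 (c0 R).
Variables (B : set K2) (k l : nat) (T : {linear submod H1 -> submod H2}).
Hypothesis B_closed : closed B.
Variable L : R.
Hypothesis TL : forall h, `|T h| <= L * `|h|.
Hypothesis L0 : 0 <= L.
Local Notation D := (derived_set B k `&` nonvanishing H2).
Local Notation W := (weak_peak_points H1).
Hypothesis D_fin : finite_set D.
Variables (eps : R) (e : E1).
Hypothesis eps01 : 0 < eps < 1.
Hypothesis e1 : `|e| = 1.
Implicit Types h : nat -> submod H1.

Definition crowded (h : nat -> submod H1) (n r : nat) : set K2 :=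
  [set y | B y /\ (r <= \sum_(j < n) (eps <= `|val (T (h j)) y|)%R)%N].

Definition large (f : submod H1) : set K2 := [set y | eps <= `|val (T f) y|].

Lemma closed_large f : closed (large f).
Proof.
apply: (@closed_comp _ _ (fun y => `|val (T f) y| : R) _ _ (@closed_ge R eps)).
move=> y _; apply: cvg_norm; exact: cts_fun.
Qed.

Lemma crowded0 h n : crowded h n 0 = B.
Proof. by apply/seteqP; split=> y; [case|split]. Qed.

Lemma crowdedS h n r :
  crowded h n.+1 r.+1 = crowded h n r.+1 `|` (crowded h n r `&` large (h n)).
Proof.
apply/seteqP; split=> y; rewrite /crowded /large /= big_ord_recr/=.
  case=> By; have [hy|hy] := leP eps; rewrite ?addn1 ?addn0 => rn; [right|left] => //.
case=> [[By rn]|[[By rn] hy]]; split=> //; first exact: leq_trans rn (leq_addr _ _).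
by rewrite hy addn1.
Qed.

Lemma closed_crowded h n r : closed (crowded h n r).
Proof.
elim: n r => [|n IHn] [|r]; rewrite ?crowded0//.
  rewrite (_ : crowded _ _ _ = set0); first exact: closed0.
  by apply/seteqP; split=> y // [_]; rewrite big_ord0.
by rewrite crowdedS; apply: closedU => //; apply: closedI => //; exact: closed_large.
Qed.

(** Each large image costs one derivation. At [r = k] none is left: no point of [B] has more than
    [k] large images. *)
Definition sparse h n := forall r, (r <= k)%N ->
  derived_set (crowded h n r.+1) (k - r) = set0.

Lemma sparse0 h : sparse h 0.
Proof.
move=> r _; rewrite (_ : crowded _ _ _ = set0) ?derived_set0//.
by apply/seteqP; split=> y // [_]; rewrite big_ord0.
Qed.

(** Where the next image must be small: [D] accounts for [B] itself, the union for the last possibly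
    nonempty derived sets of the level sets. *)
Definition exceptional h n : set K2 :=
  D `|` \bigcup_(r in `I_k) derived_set (crowded h n r.+1) (k - r.+1).

Lemma finite_exceptional h n : sparse h n -> finite_set (exceptional h n).
Proof.
move=> sh; rewrite finite_setU; split=> //.
apply: bigcup_finite => [|r rk]; first exact: finite_II.
apply: finite_derived_set; first exact: closed_crowded.
by rewrite -subSn// sh// ltnW.
Qed.

(** Points new to level [r + 1] lie in level [r] and in the closed set [large (h n)]. A point of
    their derived set of order [k - r] would be exceptional and have a large image. *)
Lemma sparseS h n : sparse h n ->
  (forall y, exceptional h n y -> `|val (T (h n)) y| < eps) -> sparse h n.+1.
Proof.
move=> sh hn r rk; apply/seteqP; split=> // y; rewrite crowdedS.
have eps0 : 0 < eps by case/andP: eps01.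
have ncl r' : closed (crowded h n r' `&` large (h n)).
  by apply: closedI; [exact: closed_crowded|exact: closed_large].
move=> /(derived_setU (@closed_crowded _ _ _) (ncl r))[]; first by rewrite sh.
move=> yr.
have ly : large (h n) y by have [] := derived_set_sub yr.
suff /hn : exceptional h n y by rewrite ltNge; move: ly => /= ->.
case: r rk yr => [_|r rk] yr.
  (* Level 0 is [B], and a large image is nonzero, which gives membership in [nonvanishing H2]. *)
  left; split.
    by move: yr; rewrite crowded0 subn0; apply: derived_setS => ? [].
  exists (val (T (h n))); first exact: valP.
  by rewrite -normr_gt0 (lt_le_trans eps0).
by right; exists r => //; apply: derived_setS yr => ? [].
Qed.

(** Models nested indicator functions times [e], whose combinations take as values the partial sums
    of the coefficients times [e], or 0. *)
Definition tame h n := forall c : nat -> R,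
  (forall i, (i < n)%N -> `|\sum_(j < i.+1) c j| <= 1) ->
  forall x, choquet_boundary H1 x ->
  `|\sum_(j < n) c j *: val (h j) x| <= 1 + 2 * n%:R * eps.

Definition near_e h n (U : set K1) := forall x j, U x -> (j < n)%N ->
  `|val (h j) x - e| <= eps.

(** The order [l + 1 - n] left at the marked point is the number of functions still to be added. *)
Definition chain h n := [/\ tame h n, sparse h n &
  exists U x, [/\ open U, near_e h n U, U x & derived_set W (l.+1 - n) x] ].

Definition update h n (h' : submod H1) :=
  fun j => if j == n then h' else h j.

Lemma update_neq h n (h' : submod H1) j : (j < n)%N -> update h n h' j = h j.
Proof. by move=> jn; rewrite /update ltn_eqF. Qed.

Lemma update_eq h n (h' : submod H1) : update h n h' n = h'.
Proof. by rewrite /update eqxx. Qed.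

Lemma crowded_update h n (h' : submod H1) r : crowded (update h n h') n r = crowded h n r.
Proof.
have e' y : (\sum_(j < n) (eps <= `|val (T (update h n h' j)) y|)%R =
    \sum_(j < n) (eps <= `|val (T (h j)) y|)%R)%N.
  by apply: eq_bigr => j _; rewrite update_neq.
by apply/seteqP; split=> y [By]; move=> rn; split=> //; move: rn; rewrite e'.
Qed.

Lemma sparse_update h n (h' : submod H1) : sparse h n ->
  (forall y, exceptional h n y -> `|val (T h') y| < eps) ->
  sparse (update h n h') n.+1.
Proof.
move=> sh hn; apply: sparseS => [r rk|y]; first by rewrite crowded_update sh.
rewrite /exceptional update_eq => ey; apply: hn; case: ey => [Dy|[r rk]]; first by left.
by rewrite crowded_update; right; exists r.
Qed.

(** Off [U] the new term has norm at most [2 * eps]. On [U] the earlier functions are near [e], so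
    the sum is nearly [e] times a convex combination of two consecutive partial sums. *)
Lemma tame_update h n (g : cfun R K1 R^o) (h' : submod H1) (U : set K1) :
  (0 < n)%N -> tame h n -> near_e h n U -> val h' = tensor g e ->
  (forall x, 0 <= g x <= 1) ->
  (forall x, choquet_boundary H1 x -> ~ U x -> g x < eps) ->
  tame (update h n h') n.+1.
Proof.
move=> n0 th hU h'E g01 gU c c1 x Chx.
have eps0 : 0 < eps by case/andP: eps01.
have /andP[gx0 gx1] := g01 x.
rewrite big_ord_recr/= update_eq h'E /=.
under eq_bigr do rewrite update_neq//.
pose S i := \sum_(j < i.+1) c j.
have c2 j : (j < n.+1)%N -> `|c j| <= 2.
  case: j => [|j] jn.
    by have := c1 0%N isT; rewrite big_ord_recr big_ord0/= add0r; lra.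
  have := c1 _ jn; have := c1 _ (ltnW jn); rewrite [X in _ -> `|X| <= _ -> _]big_ord_recr/=.
  move=> h1 h2; rewrite (_ : c _ = (S j + c j.+1) - S j); last by rewrite addrC addKr.
  by rewrite (le_trans (ler_normB _ _))//; move: h1 h2; rewrite -/(S j); lra.
have Sn : \sum_(i < n) c i = S n.-1 by rewrite /S prednK.
have cn : `|S n.-1| <= 1 by apply: c1; rewrite prednK//.
have cn1 : `|S n.-1 + c n| <= 1.
  by have := c1 n (ltnSn n); rewrite big_ord_recr/= Sn.
have [Ux|Ux] := pselect (U x); last first.
  rewrite (le_trans (ler_normD _ _))//.
  have := th c (fun i ilt => c1 i (ltnW ilt)) x Chx.
  have : `|c n *: (g x *: e)| <= 2 * eps.
    rewrite !normrZ e1 mulr1 (ger0_norm gx0) ler_pM// ?c2//.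
    by rewrite ltW// gU.
  by rewrite -natr1; lra.
have -> : \sum_(i < n) c i *: val (h i) x + c n *: (g x *: e) =
   (S n.-1 + g x * c n) *: e + \sum_(i < n) c i *: (val (h i) x - e).
  under [in RHS]eq_bigr do rewrite scalerBr.
  rewrite sumrB -scaler_suml Sn scalerDl scalerA (mulrC (c n)).
  by rewrite [RHS]addrC addrA subrK.
rewrite (le_trans (ler_normD _ _))// normrZ e1 mulr1 lerD//.
  have -> : S n.-1 + g x * c n = (1 - g x) * S n.-1 + g x * (S n.-1 + c n) by ring.
  rewrite (le_trans (ler_normD _ _))// !normrM (ger0_norm gx0) ger0_norm ?subr_ge0//.
  have : (1 - g x) * `|S n.-1| <= (1 - g x) * 1 by rewrite ler_wpM2l// subr_ge0.
  have : g x * `|S n.-1 + c n| <= g x * 1 by rewrite ler_wpM2l.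
  by lra.
rewrite (le_trans (ler_norm_sum _ _ _))//.
rewrite (@le_trans _ _ (\sum_(i < n) 2 * eps))//.
  apply: ler_sum => i _; rewrite normrZ ler_pM// ?c2// ?hU//.
  exact: ltn_trans (ltn_ord i) (ltnSn n).
rewrite sumr_const card_ord -mulr_natr -natr1; lra.
Qed.

(** The marked point is a limit of points of order [l - n], which offer peaks inside [U]. Then [U]
    shrinks to where the new function is near 1. *)
Lemma chainS h n : (0 < n <= l)%N -> chain h n -> exists h', chain h' n.+1.
Proof.
move=> /andP[n0 nl] [th sh [U [z [oU hU Uz]]]].
have eps0 : 0 < eps by case/andP: eps01.
rewrite subSn// => -[Wz lz].
have [|x [g [h' [[Wx Ux] h'E [g01 gx] gU h'Y]]]] := @peak_selection _ _ _ _ _ _ _ T L TL L0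
  (derived_set W (l - n)) U z e eps eps (exceptional h n) E2_c0 eps01 eps0
  (@derived_set_sub _ _ _) lz (open_nbhs_nbhs (conj oU Uz)).
  exact: finite_exceptional.
exists (update h n h'); split.
- exact: (tame_update n0 th hU h'E).
- exact: sparse_update.
- exists (U `&` [set x | 1 - eps < g x]), x; split.
  + apply: openI => //; apply: (open_comp _ (@open_gt R (1 - eps))) => t _.
    exact: cts_fun.
  + move=> t j [Ut gt]; rewrite ltnS leq_eqVlt => /orP[/eqP ->|jn].
      have -> : val (update h n h' n) t - e = (g t - 1) *: e.
        by rewrite update_eq h'E scalerBl scale1r.
      rewrite normrZ e1 mulr1.
      have /andP[_ g1] := g01 t.
      by rewrite ler_norml; apply/andP; split; move: gt => /=; lra.
    by rewrite update_neq// hU.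
  + by split=> //; exact: nbhs_singleton.
  + by rewrite subSS.
Qed.

Lemma chain_exists h : chain h 1 -> exists h', chain h' l.+1.
Proof.
move=> ch; suff H n : (n <= l)%N -> exists h', chain h' n.+1 by exact: H.
elim: n => [_|n IHn nl]; first by exists h.
by have [h' /chainS] := IHn (ltnW nl); apply.
Qed.

(** Only entry 0 of the constant sequence counts. With no earlier function, the levels of positive
    rank are empty and the exceptional set is [D]. *)
Lemma chain1 (h : submod H1) (U : set K1) (x : K1) :
  (forall x, choquet_boundary H1 x -> `|val h x| <= 1 + eps) ->
  (forall y, D y -> `|val (T h) y| < eps) ->
  open U -> U x -> derived_set W l x -> (forall x, U x -> `|val h x - e| <= eps) ->
  chain (fun=> h) 1.
Proof.
move=> hCh hD oU Ux Wx hU; have eps0 : 0 < eps by case/andP: eps01.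
split.
- move=> c c1 y Chy; have := c1 0%N isT; rewrite !big_ord_recr !big_ord0/= !add0r.
  rewrite normrZ => c01.
  have : `|c 0%N| * `|val h y| <= 1 * (1 + eps) by rewrite ler_pM// hCh.
  by lra.
- apply: sparseS; first exact: sparse0.
  move=> y [|[r _]]; first exact: hD.
  rewrite (_ : crowded _ _ _ = set0) ?derived_set0//.
  by apply/seteqP; split=> t // [_]; rewrite big_ord0.
- exists U, x; split=> //; last by rewrite subSS subn0.
  by move=> t j Ut _; exact: hU.
Qed.

End chains.

(** * The distortion forced by a chain *)

Section distortion.
Context {R : realType} {K1 K2 : compactHausdorffType}.
Context {E1 : normedModType R} {E2 : completeNormedModType R}.
Context {H1 : submodClosed (cfun R K1 E1)} {H2 : submodClosed (cfun R K2 E2)}.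
Variables (B : set K2) (k l : nat) (T : {linear submod H1 -> submod H2}).
Hypothesis B_boundary : boundary H2 B.
Variables L M : R.
Hypothesis TL : forall h, `|T h| <= L * `|h|.
Hypothesis L0 : 0 <= L.
Hypothesis TM : forall h, `|h| <= M * `|T h|.
Hypothesis M0 : 0 <= M.
Hypothesis kl : (0 < k <= l)%N.
Variables (eps : R) (e : E1).
Hypothesis eps01 : 0 < eps < 1.
Hypothesis e1 : `|e| = 1.

Lemma norm_le_boundary (h : submod H2) (C : R) : 0 <= C ->
  (forall y, B y -> `|val h y| <= C) -> `|h| <= C.
Proof.
move=> C0 hC; have -> : `|h| = sup [set `|val h y| | y in B].
  exact: (B_boundary (valP h)).
have [->|/set0P ne] := eqVneq [set `|val h y| | y in B] set0; first by rewrite sup0.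
by apply: ge_sup => // _ [y By <-]; exact: hC.
Qed.

(** At [n = l + 1] this is the numerator [2 * l + 2 - k] of the bound. *)
Lemma sum_weights n : \sum_(j < n) (if (j < k)%N then 1 else 2) =
  2 * n%:R - (minn n k)%:R :> R.
Proof.
elim: n => [|n IHn]; first by rewrite big_ord0 min0n; lra.
rewrite big_ord_recr/= IHn; have [nk|kn] := ltnP n k.
  rewrite (minn_idPl nk) -natr1; lra.
rewrite (minn_idPr (leqW kn)) -natr1; lra.
Qed.

(** At [x] every [h j] is close to [e], so nonnegative weights add up without cancellation. *)
Lemma chain_weights_le (h : nat -> submod H1) (w : nat -> R) n (U : set K1) x (C : R) :
  near_e eps e h n U -> U x -> (forall j, 0 <= w j) -> 0 <= C ->
  (forall y, B y -> `|\sum_(j < n) w j *: val (T (h j)) y| <= C) ->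
  (\sum_(j < n) w j) * (1 - eps) <= M * C.
Proof.
move=> hU Ux w0 C0 wC; set g := \sum_(j < n) w j *: h j.
have TgC : `|T g| <= C.
  by apply: norm_le_boundary => // y By; rewrite val_linear_sumZ wC.
apply: (@le_trans _ _ `|g|); last by rewrite (le_trans (TM _))// ler_wpM2l.
apply: (@le_trans _ _ `|val g x|); last exact: norm_val_le.
rewrite val_sumZ.
have -> : \sum_(j < n) w j *: val (h j) x =
    (\sum_(j < n) w j) *: e + \sum_(j < n) w j *: (val (h j) x - e).
  rewrite scaler_suml -big_split/=; apply: eq_bigr => j _.
  by rewrite scalerBr addrC subrK.
set s := \sum_(j < n) w j; set v := \sum_(j < n) _.
have s0 : 0 <= s by apply: sumr_ge0.
have vs : `|v| <= s * eps.
  rewrite (le_trans (ler_norm_sum _ _ _))// mulr_suml; apply: ler_sum => j _.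
  by rewrite normrZ ger0_norm// ler_wpM2l// hU.
have := ler_normB (s *: e + v) v; rewrite addrK normrZ e1 ger0_norm//; lra.
Qed.

(** [few_large_terms] applies at each point of [B]: its norm bound comes from [tame], its count from
    [sparse] at [r = k]. *)
Lemma chain_distortion (h : nat -> submod H1) :
  chain B k l T eps e h l.+1 ->
  (2 * l%:R + 2 - k%:R) * (1 - eps) <=
    M * (k%:R * (L * (1 + 2 * l.+1%:R * eps) + eps) + 2 * l.+1%:R * eps) /\
  3 * (1 - eps) <= M * (L * (1 + 2 * l.+1%:R * eps) + 2 * eps).
Proof.
have /andP[k0 kl'] := kl; have /andP[eps0 eps1] := eps01.
move=> [th sh [U [x [_ hU Ux _]]]].
set Q := L * (1 + _).
have Q0 : 0 <= Q by rewrite mulr_ge0// addr_ge0// mulr_ge0// ltW.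
have few y : B y -> `|\sum_(j < l.+1) (if (j < k)%N then 1 else 2) *: val (T (h j)) y| <=
     k%:R * (Q + eps) + 2 * l.+1%:R * eps /\
    `|val (T (h 0%N)) y + 2 *: val (T (h l)) y| <= Q + 2 * eps.
  move=> By; apply: (@few_large_terms _ _ (fun j => val (T (h j)) y)) => //.
    move=> c c1; rewrite -val_linear_sumZ (le_trans (norm_val_le _ _))//.
    rewrite (le_trans (TL _))// ler_wpM2l//; apply: norm_le_choquet => [|t Cht].
      by rewrite addr_ge0// mulr_ge0// ltW.
    by rewrite val_sumZ; apply: th.
  rewrite leqNgt; apply/negP => ky.
  by have := sh k (leqnn _); rewrite subnn => /seteqP[/(_ y) + _]; apply; split.
split.
  have := @chain_weights_le h (fun j => if (j < k)%N then 1 else 2) l.+1 U x _ hU Ux _ _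
    (fun y By => (few y By).1).
  rewrite sum_weights (minn_idPr (leqW kl')) -natr1 => H.
  rewrite (le_trans _ (H _ _))//; last 2 first.
  - by move=> j; case: ifP.
  - by rewrite addr_ge0 ?mulr_ge0 ?addr_ge0// ltW.
  by rewrite ler_pM2r; lra.
have l0 : (0 < l)%N := leq_trans k0 kl'.
pose w j : R := (j == 0)%:R + 2 * (j == l)%:R.
have sw (V : lmodType R) (a : nat -> V) : \sum_(j < l.+1) w j *: a j = a 0%N + 2 *: a l.
  under eq_bigr do rewrite scalerDl -scalerA.
  by rewrite big_split/= -scaler_sumr !sum_deltaZ.
have := @chain_weights_le h w l.+1 U x (Q + 2 * eps) hU Ux _ _ _.
have -> : \sum_(j < l.+1) w j = 3.
  rewrite big_split/= -mulr_sumr !sum_delta ltnSn /=; lra.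
apply.
- by move=> j; rewrite addr_ge0// mulr_ge0.
- by rewrite addr_ge0// mulr_ge0// ltW.
- by move=> y /few[_]; rewrite (sw _ (fun j => val (T (h j)) y)).
Qed.

End distortion.

Lemma le_of_eps_le {R : realType} (a b c d : R) : 0 <= b ->  0 <= d ->
  (forall eps : R, 0 < eps < 1 -> a - b * eps <= c + d * eps) -> a <= c.
Proof.
move=> b0 d0 H; rewrite leNgt; apply/negP => ca.
have s0 : 0 < b + d + 1 + (a - c) by lra.
(* This value [t] of [eps] gives [(b + d) * t < a - c], against the hypothesis. *)
have s1 : 0 < (a - c) / (b + d + 1 + (a - c)) < 1.
  by rewrite divr_gt0 ?subr_gt0//= ltr_pdivrMr//; lra.
have := H _ s1; set t := _ / _ in s1 *.
have : t * (b + d + 1 + (a - c)) = a - c by rewrite /t mulfVK// gt_eqF.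
move: s1 => /andP[t0 t1]; have : 0 < t * (a - c) by rewrite mulr_gt0// subr_gt0.
by nra.
Qed.

(** * Starting a chain under each of the three conditions *)

Section chain_start.
Context {R : realType} {K1 K2 : compactHausdorffType}.
Context {E1 : normedModType R} {E2 : completeNormedModType R}.
Context {H1 : submodClosed (cfun R K1 E1)} {H2 : submodClosed (cfun R K2 E2)}.
Hypothesis E2_c0 : ~ contains_isomorphic_copy E2 (c0 R).
Variables (B : set K2) (k l : nat) (T : {linear submod H1 -> submod H2}).
Hypothesis B_closed : closed B.
Variable L : R.
Hypothesis TL : forall h, `|T h| <= L * `|h|.
Hypothesis L0 : 0 <= L.
Local Notation D := (derived_set B k `&` nonvanishing H2).
Local Notation W := (derived_set (weak_peak_points H1) l).
Variable eps : R.
Hypothesis eps01 : 0 < eps < 1.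

Let eps0 : 0 < eps. Proof. by case/andP: eps01. Qed.

Lemma tensor_chain1 (g : cfun R K1 R^o) (e : E1) (h : submod H1) (x : K1) :
  `|e| = 1 -> val h = tensor g e -> (forall t, 0 <= g t <= 1) -> 1 - eps < g x ->
  W x -> (forall y, D y -> `|val (T h) y| < eps) ->
  chain B k l T eps e (fun=> h) 1.
Proof.
move=> e1 hE g01 gx Wx hD.
apply: (@chain1 _ _ _ _ _ _ _ _ _ _ _ B_closed _ _ eps01 _
  [set t | 1 - eps < g t] x) => // [t _||t gt].
- have /andP[g0 g1] := g01 t.
  rewrite hE /= normrZ e1 mulr1 ger0_norm// (le_trans g1)// lerDl; exact: ltW.
- by apply: (open_comp _ (@open_gt R (1 - eps))) => t _; exact: cts_fun.
- have -> : val h t - e = (g t - 1) *: e by rewrite hE scalerBl scale1r.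
  rewrite normrZ e1 mulr1; have /andP[_ g1] := g01 t.
  by rewrite ler_norml; apply/andP; split; move: gt => /=; lra.
Qed.

(** Condition (i): any peak function at a point of [W] will do, smallness on [D] being vacuous. *)
Lemma chain1_empty (e : E1) : `|e| = 1 -> W !=set0 -> D = set0 ->
  exists h, chain B k l T eps e h 1.
Proof.
move=> e1 [x Wx] D0.
have [g [[_ gH] g01 gx _]] := derived_set_sub Wx setT eps filterT eps01.
exists (fun=> Submod (gH e)); apply: (tensor_chain1 (g := g) (x := x)) => //.
by move=> y; rewrite D0.
Qed.

(** Condition (ii): a limit point of [W] supplies the candidates for [peak_selection]. *)
Lemma chain1_infinite (e : E1) : `|e| = 1 -> infinite_set W -> finite_set D ->
  exists h, chain B k l T eps e h 1.
Proof.
move=> e1 /infinite_limit_point[z Wz] Dfin.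
have [x [g [h [[Wx _] hE [g01 gx] _ hD]]]] := peak_selection TL L0 e E2_c0 eps01
  eps0 (@derived_set_sub _ _ _) Wz filterT Dfin.
by exists (fun=> h); exact: (tensor_chain1 (g := g) (x := x)).
Qed.

Lemma dsum_norm_attained (E : normedModType R) n (v : dsum E n) : (0 < n)%N ->
  exists i, `|v| = `|v i|.
Proof.
move=> n0; case: (@arg_maxP _ _ _ (Ordinal n0) xpredT (fun i => `|v i|) isT) => i _ vi.
exists i; apply/eqP; rewrite eq_le; apply/andP; split.
  by apply: sup_norm_le => // j; exact: vi.
exact: sup_norm_ub (dsum_bounded v).
Qed.

Lemma disjoint_peaks_sum n (w : 'I_n -> K1) : injective w ->
  (forall i, weak_peak_points H1 (w i)) ->
  exists g : 'I_n -> cfun R K1 R^o, [/\ forall i, canonical_space_tensor H1 (g i),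
    forall i x, 0 <= g i x <= 1,
    forall x, choquet_boundary H1 x -> \sum_i g i x <= 1 + eps &
    forall i, \sum_j `|(g j (w i) : R) - (j == i)%:R| < eps].
Proof.
move=> winj wW; have [V [Vw Vdisj]] := finite_disjoint_nbhs winj.
(* Small enough for [n] errors to add up to less than [eps]. *)
pose d : R := eps / n.+1%:R.
have d0 : 0 < d by rewrite divr_gt0.
have dn : d * n%:R < eps.
  by rewrite /d mulrAC ltr_pdivrMr// ltr_pM2l// ltr_nat.
have d01 : 0 < d < 1.
  rewrite d0 /d ltr_pdivrMr// mul1r; have /andP[_ /lt_le_trans] := eps01; apply.
  by rewrite ler1n.
clearbody d.
have /choice[g Hg] i : exists g : cfun R K1 R^o,
    [/\ canonical_space_tensor H1 g, forall y, 0 <= g y <= 1, 1 - d < g (w i) &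
        forall y, choquet_boundary H1 y -> ~ V i y -> g y < d].
  by have [g] := wW i (V i) d (Vw i) d01; exists g.
(* Off [V j] the function [g j] is controlled only on the Choquet boundary; [weak_peak_closure] and
   continuity carry the bound to [w i]. *)
have gsmall i j : j != i -> g j (w i) <= d.
  move=> ji; rewrite leNgt; apply/negP => gd.
  have : nbhs (w i) (V i `&` [set t | d < g j t]).
    apply: filterI => //; apply: open_nbhs_nbhs; split=> //.
    by apply: (open_comp _ (@open_gt R d)) => t _; exact: cts_fun.
  move=> /(weak_peak_closure (wW i))[t [Ct [Vt /= dt]]].
  have [_ _ _ /(_ t Ct)] := Hg j; rewrite ltNge (ltW dt) => H.
  suff : ~ V j t by move/H.
  by move=> Vj; move: ji; rewrite (Vdisj _ _ _ Vj Vt) eqxx.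
exists g; split=> [i|i x|x Cx|i].
- by have [] := Hg i.
- by have [] := Hg i.
- have gd i : ~ V i x -> g i x <= d by move=> Vx; apply/ltW; have [_ _ _] := Hg i; exact.
  have sd : \sum_(i < n) d < eps by rewrite sumr_const card_ord -mulr_natr.
  have [[m Vm]|/forallNP nV] := pselect (exists m, V m x); last first.
    have : \sum_i g i x <= \sum_(i < n) d by apply: ler_sum => i _; exact: gd.
    lra.
  have : \sum_i g i x <= \sum_(i < n) ((i == m)%:R + d).
    apply: ler_sum => i _; have [->|im] := eqVneq i m.
      have [_ /(_ x)/andP[_ g1] _ _] := Hg m; rewrite (le_trans g1)// lerDl; exact: ltW.
    rewrite add0r gd// => Vi; move: im.
    by rewrite (Vdisj _ _ _ Vi Vm) eqxx.
  have -> : \sum_(i < n) ((i == m)%:R + d) = 1 + \sum_(i < n) d.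
    rewrite big_split/= (bigD1 m)//= eqxx big1 ?addr0//.
    by move=> i /negbTE->.
  lra.
- apply: le_lt_trans dn; rewrite -[X in d * X%:R]card_ord mulr_natr -sumr_const.
  apply: ler_sum => j _; have [->|ji] := eqVneq j i.
    have [_ /(_ (w i))/andP[_ g1] gw _] := Hg i.
    rewrite ler_norml; apply/andP; rewrite /= mulr1n; split; lra.
  have [_ /(_ (w i))/andP[g0 _] _ _] := Hg j.
  by rewrite subr0 ger0_norm// gsmall.
Qed.

(** Condition (iii): evaluating on [D] the images of peak sums gives an operator [P] that cannot be
    bounded below by [eps]. A vector violating this bound gives the start, with [e] its normalized
    coordinate of largest norm. *)
Lemma chain1_finite : finite_set W -> finite_set D ->
  ~ contains_isomorphic_copy (dsum E2 #|` fset_set D|) (dsum E1 #|` fset_set W|) ->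
  exists (e : E1) h, `|e| = 1 /\ chain B k l T eps e h 1.
Proof.
move=> Wfin Dfin nocopy.
set m := #|` fset_set D| in nocopy; set n := #|` fset_set W| in nocopy.
(* [dsum E1 0] is zero and embeds everywhere, so [nocopy] excludes an empty [W]. *)
have n0 : (0 < n)%N.
  rewrite lt0n; apply/eqP => n0; apply: nocopy; rewrite n0.
  pose Z := (\0 : dsum E1 0 -> dsum E2 m).
  have v0 (v : dsum E1 0) : `|v| = 0.
    apply/eqP; rewrite eq_le normr_ge0 andbT; apply: sup_norm_le => // -[].
    by case.
  apply: (@bounded_below_contains_copy _ _ _ Z 0 1) => // v; rewrite v0 mulr0//.
  by rewrite -[leLHS]/(`|0 : dsum E2 m|) normr0.
pose w (i : 'I_n) := tnth (in_tuple (enum_fset (fset_set W))) i.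
have winj : injective w by apply/tuple_uniqP; exact: fset_uniq.
have wW i : W (w i).
  by apply/set_mem; rewrite -(in_fset_set Wfin); exact: mem_tnth.
have [g [gH g01 gsum gw]] := disjoint_peaks_sum winj (fun i => derived_set_sub (wW i)).
pose F (v : dsum E1 n) : submod H1 := \sum_i Submod ((gH i).2 (v i)).
have FE v t : val (F v) t = \sum_i g i t *: v i by exact: val_sum.
have FL v : `|F v| <= n%:R * `|v|.
  apply: sup_norm_le => [|t]; first by rewrite mulr_ge0.
  rewrite FE (le_trans (ler_norm_sum _ _ _))// mulrC mulr_natr.
  rewrite -[X in _ *+ X]card_ord -sumr_const; apply: ler_sum => i _.
  have /andP[g0 g1] := g01 i t.
  rewrite normrZ ger0_norm// (le_trans (ler_wpM2r _ g1))// mul1r.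
  exact: sup_norm_ub (dsum_bounded v).
have Flin : linear F.
  move=> a u v; apply: val_inj; apply: cfunP => t.
  rewrite (_ : val (a *: F u + F v) t = a *: val (F u) t + val (F v) t)// !FE.
  rewrite scaler_sumr -big_split/=; apply: eq_bigr => i _.
  by rewrite !ffunE scalerDr !scalerA mulrC.
pose Phi v : dsum E2 m :=
  [ffun j : 'I_m => val (T (F v)) (tnth (in_tuple (enum_fset (fset_set D))) j)].
have Philin : linear Phi.
  move=> a u v; apply/ffunP => j; by rewrite !ffunE Flin linearP.
pose P0 := GRing.isLinear.Build _ _ _ _ _ Philin.
pose P : {linear dsum E1 n -> dsum E2 m} := HB.pack Phi P0.
have PhiL v : `|P v| <= L * n%:R * `|v|.
  apply: sup_norm_le => [|j]; first by rewrite !mulr_ge0.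
  rewrite ffunE (le_trans (norm_val_le _ _))// (le_trans (TL _))//.
  by rewrite -mulrA ler_wpM2l.
have [v vP] : exists v, `|P v| < eps * `|v|.
  apply: contrapT => /forallNP H; apply: nocopy.
  by apply: (@bounded_below_contains_copy _ _ _ P _ eps) PhiL _ => // v;
    rewrite leNgt; apply/negP.
have v0 : 0 < `|v|.
  rewrite normr_gt0; apply/eqP => v0; move: vP.
  by rewrite v0 linear0 !normr0 mulr0 ltxx.
pose u := `|v|^-1 *: v.
have [i vi] := dsum_norm_attained v n0.
have uE j : u j = `|v|^-1 *: v j by rewrite /u ffunE.
have u1 j : `|u j| <= 1.
  rewrite uE normrZ normfV normr_id ler_pdivrMl// mulr1.
  exact: sup_norm_ub (dsum_bounded v).
have ui : `|u i| = 1 by rewrite uE normrZ normfV normr_id -vi mulVf// gt_eqF.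
have Pu : `|P u| < eps.
  by rewrite linearZ normrZ normfV normr_id ltr_pdivrMl// mulrC.
exists (u i), (fun=> F u); split=> //.
apply: (@chain1 _ _ _ _ _ _ _ _ _ _ _ B_closed _ _ eps01 _
    [set t | `|val (F u) t - u i| < eps] (w i)) => //.
- move=> x Cx; rewrite FE (le_trans _ (gsum x Cx))// (le_trans (ler_norm_sum _ _ _))//.
  apply: ler_sum => j _; have /andP[gx0 _] := g01 j x.
  by rewrite normrZ ger0_norm// ler_piMr.
- move=> y Dy; have : y \in enum_fset (fset_set D).
    by rewrite -[_ \in _]/(y \in fset_set D) in_fset_set// inE.
  move=> /(tnthP (in_tuple _))[j ->]; rewrite (le_lt_trans _ Pu)//.
  by have := sup_norm_ub j (dsum_bounded (Phi u)); rewrite ffunE.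
- apply: (@open_comp _ _ (fun t => `|val (F u) t - u i| : R) _ _ (@open_lt R eps)).
  move=> t _; apply: cvg_norm; apply: cvgB; [exact: cts_fun|exact: cvg_cst].
- rewrite /= FE (le_lt_trans _ (gw i))//.
  have -> : \sum_j g j (w i) *: u j - u i = \sum_j (g j (w i) - (j == i)%:R) *: u j.
    under [in RHS]eq_bigr do rewrite scalerBl.
    rewrite sumrB; congr (_ - _); rewrite (bigD1 i)//= eqxx scale1r big1 ?addr0//.
    by move=> j /negbTE->; rewrite scale0r.
  rewrite (le_trans (ler_norm_sum _ _ _))//; apply: ler_sum => j _.
  by rewrite normrZ ler_piMr.
- by move=> t /ltW.
Qed.

End chain_start.

(** * The distortion bound, by letting the error tend to 0 *)

Theorem theorem1p3 (R : realType)
  (K1 K2 : compactHausdorffType)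
  (E1 E2 : completeNormedModType R)
  (E1_neq0 : exists e : E1, e != 0)
  (E2_neq0 : exists e : E2, e != 0)
  (H1 : submodClosed (cfun R K1 E1)) (H2 : submodClosed (cfun R K2 E2))
  (H1_neq0 : exists h : submod H1, h != 0)
  (H2_neq0 : exists h : submod H2, h != 0)
  (H1_closed : closed [set` H1]) (H2_closed : closed [set` H2])
  (E2_c0 : ~ contains_isomorphic_copy E2 (c0 R))
  (B : set K2) (B_closed : closed B) (B_boundary : boundary H2 B)
  (T : {linear submod H1 -> submod H2}) (Tinv : submod H2 -> submod H1)
  (T_iso : into_isomorphism T Tinv)
  (l k : nat) (k_gt0 : (0 < k)%N) (k_le_l : (k <= l)%N) :
  let W := derived_set (weak_peak_points H1) l in
  let D := derived_set B k `&` nonvanishing H2 in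
  [\/ W !=set0 /\ D = set0,
      infinite_set W /\ finite_set D |
      [/\ finite_set W, finite_set D &
          ~ contains_isomorphic_copy (dsum E2 #|` fset_set D|)
                                     (dsum E1 #|` fset_set W|)]] ->
  opnorm T * opnorm_on (range T) Tinv >=
    Num.max 3 ((2 * l%:R + 2 - k%:R) / k%:R).
Proof.
move=> W D WD; have [Tc TK _] := T_iso.
set L := opnorm T; set M := opnorm_on (range T) Tinv.
have TL h : `|T h| <= L * `|h| by exact: opnorm_le_norm.
have TM h : `|h| <= M * `|T h| by exact: into_isomorphism_le_norm.
have [h0 h0n] := H1_neq0.
have Th0 : 0 < `|T h0|.
  rewrite normr_gt0; apply: contra_neq h0n => Th0.
  by rewrite -(TK h0) Th0 -[X in Tinv X](linear0 T) TK.
have L0 : 0 <= L.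
  by have := lt_le_trans Th0 (TL h0); rewrite pmulr_lgt0 ?normr_gt0// => /ltW.
have M0 : 0 <= M.
  have : 0 < M * `|T h0| by apply: lt_le_trans (TM h0); rewrite normr_gt0.
  by rewrite pmulr_lgt0// => /ltW.
have [e e1] : exists e : E1, `|e| = 1.
  have [e0 e0n] := E1_neq0; exists (`|e0|^-1 *: e0).
  by rewrite normrZ normfV normr_id mulVf// normr_eq0.
have Dfin : finite_set D.
  by case: WD => [[_ ->]|[_ ?]|[_ ? _]] //; exact: finite_set0.
have kl : (0 < k <= l)%N by rewrite k_gt0.
have key eps : 0 < eps < 1 ->
   (2 * l%:R + 2 - k%:R) * (1 - eps) <=
    M * (k%:R * (L * (1 + 2 * l.+1%:R * eps) + eps) + 2 * l.+1%:R * eps) /\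
   3 * (1 - eps) <= M * (L * (1 + 2 * l.+1%:R * eps) + 2 * eps).
  move=> eps01.
  have [e' [h [e1' ch]]] : exists (e : E1) h, `|e| = 1 /\ chain B k l T eps e h 1.
    case: WD => [[W0 D0]|[Winf _]|[Wfin _ nocopy]].
    - by have [h] := chain1_empty T B_closed eps01 e1 W0 D0; exists e, h.
    - have [h] := chain1_infinite E2_c0 B_closed TL L0 eps01 e1 Winf Dfin.
      by exists e, h.
    - exact: (chain1_finite B_closed TL L0 eps01 Wfin Dfin nocopy).
  have [h' ch'] := chain_exists E2_c0 B_closed TL L0 Dfin eps01 e1' ch.
  exact: (chain_distortion B_boundary TL L0 TM M0 kl eps01 e1' ch').
have l0 : 0 <= l%:R :> R by [].
have k0 : 0 < k%:R :> R by rewrite ltr0n.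
have kl' : k%:R <= l%:R :> R by rewrite ler_nat.
rewrite ge_max; apply/andP; split.
  rewrite mulrC.
  (* The constants are the coefficients of [eps] on the two sides of [key]. *)
  apply: (@le_of_eps_le _ _ 3 _ (M * (L * (2 * l.+1%:R) + 2))) => //.
    by rewrite mulr_ge0// addr_ge0// !mulr_ge0.
  move=> eps /key[_ H]; rewrite (_ : 3 - 3 * eps = 3 * (1 - eps)); last by ring.
  by rewrite (le_trans H)//; rewrite le_eqVlt; apply/orP; left; apply/eqP; ring.
rewrite ler_pdivrMr//.
apply: (@le_of_eps_le _ _ (2 * l%:R + 2 - k%:R) _
  (M * (k%:R * (L * (2 * l.+1%:R) + 1) + 2 * l.+1%:R))).
- lra.
- by rewrite mulr_ge0// addr_ge0 ?mulr_ge0// ?addr_ge0 ?mulr_ge0.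
move=> eps /key[H _].
rewrite (_ : _ - _ * eps = (2 * l%:R + 2 - k%:R) * (1 - eps)); last by ring.
by rewrite (le_trans H)// le_eqVlt; apply/orP; left; apply/eqP; ring.
Qed.
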